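(* Let $R$ be a commutative ring with unit. For every integer $r\geq 0$, the category $\mathbf{F}\mathrm{C}_R$ of filtered complexes of $R$-modules admits a right proper cofibrantly generated model structure, where: (1) weak equivalences are the $Z_r$-quasi-isomorphisms; (2) fibrations are the morphisms of filtered complexes $f:A\to B$ such that $Z_r(f)$ is bidegree-wise surjective; and (3) $I''_r=\{R^{n+1}_{(p-r)}\to\mathcal{Z}_r(p,n)\}_{p,n\in\mathbb{Z}}$ and $J''_r=\{0\to\mathcal{Z}_r(p,n)\}_{p,n\in\mathbb{Z}}$ are the sets of generating cofibrations and generating trivial cofibrations respectively.
   Context: Complexes are cochain complexes, unbounded. A filtered $R$-module $(A,F)$ is an $R$-module $A$ with submodules $F_pA$, $p\in\mathbb{Z}$, such that $F_{p-1}A\subseteq F_pA$ (no boundedness condition). A filtered complex $(A,d,F)$ is a cochain complex $(A,d)$ of $R$-modules with a filtration $F$ of each $A^n$ such that $d(F_pA^n)\subseteq F_pA^{n+1}$ for all $p,n\in\mathbb{Z}$; morphisms are morphisms of complexes with $f(F_pA^n)\subseteq F_pB^n$. An $r$-bigraded complex is a $(\mathbb{Z},\mathbb{Z})$-bigraded $R$-module $\{A^{i,j}\}$ with maps $\delta_r:A^{i,j}\to A^{i-r,j+1-r}$, $\delta_r^2=0$; a quasi-isomorphism is a bidegree $(0,0)$ map commuting with the differentials and inducing an isomorphism on cohomology. For a filtered complex $A$ put $Z_r^{p,n+p}(A)=F_pA^n\cap d^{-1}(F_{p-r}A^{n+1})$; with the differential $d:Z_r^{p,n+p}(A)\to Z_r^{p-r,n+1+p-r}(A)$,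 $Z_r(A)$ is an $r$-bigraded complex, functorial in $A$. A morphism $f$ is a $Z_r$-quasi-isomorphism if $Z_r(f)$ is a quasi-isomorphism of $r$-bigraded complexes. $R^n_{(p)}$ denotes $R$ in degree $n$, pure of weight $p$ (i.e. $F_{p-1}=0$, $F_p=R$); it is also viewed as a filtered complex concentrated in degree $n$. $\mathcal{Z}_r(p,n)=\big(R^n_{(p)}\xrightarrow{1}R^{n+1}_{(p-r)}\big)$ is the filtered complex concentrated in degrees $n,n+1$. The map $R^{n+1}_{(p-r)}\to\mathcal{Z}_r(p,n)$ is the inclusion of the degree $n+1$ part. *)

(* Defs.v *)
From HB Require Import structures.
From mathcomp Require Import all_boot all_order all_algebra.
From mathcomp Require Import boolp zify.

Set Implicit Arguments.
Unset Strict Implicit.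
Unset Printing Implicit Defensive.

Import Order.TTheory GRing.Theory Num.Theory.
Local Open Scope ring_scope.
Local Open Scope quotient_scope.

(** A set is small if it lives in the universe of the carriers of modules. *)

Notation small_type := Type@{GRing.Lmodule.axioms_.u0}.

Record category_on (O : Type) (H : O -> O -> Type) := CategoryOn {
  idm_on : forall a, H a a;
  comp_on : forall a b c, H b c -> H a b -> H a c;
  comp1m_on : forall a b (f : H a b), comp_on (idm_on b) f = f;
  compm1_on : forall a b (f : H a b), comp_on f (idm_on a) = f;
  compA_on : forall a b c d (h : H c d) (g : H b c) (f : H a b),
    comp_on h (comp_on g f) = comp_on (comp_on h g) f
}.

Record category := Category {
  ob :> Type;
  mor : ob -> ob -> Type;
  cat_on : category_on mor
}.

Definition idm (C : category) (a : C) : mor a a := idm_on (cat_on C) a.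
Definition mcomp (C : category) (a b c : C) (g : mor b c) (f : mor a b) :
  mor a c := comp_on (cat_on C) g f.

Declare Scope cat_scope.
Delimit Scope cat_scope with cat.
Local Open Scope cat_scope.
Notation "g ∘ f" := (mcomp g f) (at level 40, left associativity) : cat_scope.

Record small_category := SmallCategory {
  sob : small_type;
  shom : sob -> sob -> small_type;
  scat_on : category_on shom
}.

Coercion category_of_small (J : small_category) : category :=
  Category (scat_on J).

Record functor (J C : category) := Functor {
  fob :> J -> C;
  fmap : forall a b : J, mor a b -> mor (fob a) (fob b);
  fmap_id : forall a : J, fmap (idm a) = idm (fob a);
  fmap_comp : forall (a b c : J) (g : mor b c) (f : mor a b),
    fmap (g ∘ f) = fmap g ∘ fmap f
}.

Record cone (J C : category) (F : functor J C) (L : C) := Cone {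
  cone_leg : forall j : J, mor L (F j);
  cone_nat : forall (j k : J) (u : mor j k), fmap F u ∘ cone_leg j = cone_leg k
}.

Definition is_limit (J C : category) (F : functor J C) (L : C)
    (c : cone F L) : Prop :=
  forall (L' : C) (c' : cone F L'),
    exists! h : mor L' L, forall j, cone_leg c j ∘ h = cone_leg c' j.

Record cocone (J C : category) (F : functor J C) (L : C) := Cocone {
  cocone_leg : forall j : J, mor (F j) L;
  cocone_nat : forall (j k : J) (u : mor j k), 
    cocone_leg k ∘ fmap F u = cocone_leg j
}.

Definition is_colimit (J C : category) (F : functor J C) (L : C)
    (c : cocone F L) : Prop :=
  forall (L' : C) (c' : cocone F L'),
    exists! h : mor L L', forall j, h ∘ cocone_leg c j = cocone_leg c' j.

Definition has_small_limits (C : category) : Prop :=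
  forall (J : small_category) (F : functor J C),
    exists (L : C) (c : cone F L), is_limit c.

Definition has_small_colimits (C : category) : Prop :=
  forall (J : small_category) (F : functor J C),
    exists (L : C) (c : cocone F L), is_colimit c.

(** The square with top [u], bottom [v], left [f], right [g], that is
    [v ∘ f = g ∘ u], is a pullback, resp. a pushout. *)
Definition is_pullback (C : category) (a b c d : C) (f : mor a b)
    (u : mor a c) (v : mor b d) (g : mor c d) : Prop :=
  v ∘ f = g ∘ u /\
  forall (e : C) (x : mor e b) (y : mor e c), v ∘ x = g ∘ y ->
    exists! h : mor e a, f ∘ h = x /\ u ∘ h = y.

Definition is_pushout (C : category) (a b c d : C) (f : mor a b)
    (u : mor a c) (v : mor b d) (g : mor c d) : Prop :=
  v ∘ f = g ∘ u /\
  forall (e : C) (x : mor b e) (y : mor c e), x ∘ f = y ∘ u ->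
    exists! h : mor d e, h ∘ v = x /\ h ∘ g = y.

Definition mor_class (C : category) := forall a b : C, mor a b -> Prop.

Definition subcategory_class (C : category) (P : mor_class C) : Prop :=
  (forall a : C, P a a (idm a)) /\
  (forall (a b c : C) (g : mor b c) (f : mor a b),
    P _ _ f -> P _ _ g -> P _ _ (g ∘ f)).

Definition two_of_three (C : category) (P : mor_class C) : Prop :=
  forall (a b c : C) (g : mor b c) (f : mor a b),
    [/\ P _ _ f -> P _ _ g -> P _ _ (g ∘ f),
        P _ _ f -> P _ _ (g ∘ f) -> P _ _ g
      & P _ _ g -> P _ _ (g ∘ f) -> P _ _ f].

Definition retract_of (C : category) (a b c d : C)
    (f : mor a b) (g : mor c d) : Prop :=
  exists (i : mor a c) (p : mor c a) (i' : mor b d) (p' : mor d b),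
    [/\ p ∘ i = idm a, p' ∘ i' = idm b, g ∘ i = i' ∘ f & f ∘ p = p' ∘ g].

Definition retract_closed (C : category) (P : mor_class C) : Prop :=
  forall (a b c d : C) (f : mor a b) (g : mor c d),
    retract_of f g -> P _ _ g -> P _ _ f.

(** [f] has the left lifting property with respect to [g]. *)
Definition lifts (C : category) (a b c d : C)
    (f : mor a b) (g : mor c d) : Prop :=
  forall (u : mor a c) (v : mor b d), v ∘ f = g ∘ u ->
    exists h : mor b c, h ∘ f = u /\ g ∘ h = v.

Record functorial_factorization (C : category) (P Q : mor_class C) :=
FunctorialFactorization {
  ff_ob : forall a b : C, mor a b -> C;
  ff_l : forall (a b : C) (f : mor a b), mor a (ff_ob f);
  ff_r : forall (a b : C) (f : mor a b), mor (ff_ob f) b;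
  ff_fact : forall (a b : C) (f : mor a b), ff_r f ∘ ff_l f = f;
  ff_lP : forall (a b : C) (f : mor a b), P _ _ (ff_l f);
  ff_rP : forall (a b : C) (f : mor a b), Q _ _ (ff_r f);
  ff_map : forall (a b a' b' : C) (f : mor a b) (f' : mor a' b')
    (u : mor a a') (v : mor b b'), v ∘ f = f' ∘ u ->
    mor (ff_ob f) (ff_ob f');
  ff_map_l : forall (a b a' b' : C) (f : mor a b) (f' : mor a' b')
    (u : mor a a') (v : mor b b') (e : v ∘ f = f' ∘ u),
    ff_map e ∘ ff_l f = ff_l f' ∘ u;
  ff_map_r : forall (a b a' b' : C) (f : mor a b) (f' : mor a' b')
    (u : mor a a') (v : mor b b') (e : v ∘ f = f' ∘ u),
    ff_r f' ∘ ff_map e = v ∘ ff_r f;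
  ff_map_id : forall (a b : C) (f : mor a b) (e : idm b ∘ f = f ∘ idm a),
    ff_map e = idm (ff_ob f);
  ff_map_comp : forall (a b a' b' a'' b'' : C)
    (f : mor a b) (f' : mor a' b') (f'' : mor a'' b'')
    (u : mor a a') (v : mor b b') (u' : mor a' a'') (v' : mor b' b'')
    (e : v ∘ f = f' ∘ u) (e' : v' ∘ f' = f'' ∘ u')
    (e'' : (v' ∘ v) ∘ f = f'' ∘ (u' ∘ u)),
    ff_map e'' = ff_map e' ∘ ff_map e
}.

Definition class_and (C : category) (P Q : mor_class C) : mor_class C :=
  fun a b f => P a b f /\ Q a b f.

(** The axioms are those of M. Hovey, Model categories, Section 1.1. *)
Record model_structure (C : category) := ModelStructure {
  model_complete : has_small_limits C;
  model_cocomplete : has_small_colimits C;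
  weq : mor_class C;
  cof : mor_class C;
  fib : mor_class C;
  weq_sub : subcategory_class weq;
  cof_sub : subcategory_class cof;
  fib_sub : subcategory_class fib;
  weq_two_of_three : two_of_three weq;
  weq_retract : retract_closed weq;
  cof_retract : retract_closed cof;
  fib_retract : retract_closed fib;
  trivcof_fib_lifts : forall (a b c d : C) (f : mor a b) (g : mor c d),
    cof f -> weq f -> fib g -> lifts f g;
  cof_trivfib_lifts : forall (a b c d : C) (f : mor a b) (g : mor c d),
    cof f -> fib g -> weq g -> lifts f g;
  cof_trivfib_fact : functorial_factorization cof (class_and fib weq);
  trivcof_fib_fact : functorial_factorization (class_and cof weq) fib
}.

Definition right_proper (C : category) (M : model_structure C) : Prop :=
  forall (a b c d : C) (f : mor a b) (u : mor a c) (v : mor b d) (g : mor c d),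
    is_pullback f u v g -> fib M g -> weq M v -> weq M u.

(** An ordinal is represented by a small well-ordered type. *)
Record wellorder := WellOrder {
  wo :> small_type;
  wlt : wo -> wo -> Prop;
  wlt_wf : well_founded wlt;
  wlt_trans : forall u v w, wlt u v -> wlt v w -> wlt u w;
  wlt_total : forall v w, wlt v w \/ v = w \/ wlt w v
}.

Definition wle (W : wellorder) (v w : W) : Prop := v = w \/ wlt v w.

Lemma wle_refl (W : wellorder) (w : W) : wle w w.
Proof. by left. Qed.

Lemma wle_trans (W : wellorder) (u v w : W) : wle v w -> wle u v -> wle u w.
Proof.
case=> [-> //|vw] [->|uv]; first by right.
by right; apply: wlt_trans uv vw.
Qed.

Definition wle_category_on (W : wellorder) (T : Type) (p : T -> W) :
    category_on (fun v w : T => wle (p v) (p w)) :=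
  @CategoryOn T (fun v w => wle (p v) (p w))
    (fun v => wle_refl (p v))
    (fun u v w => @wle_trans W (p u) (p v) (p w))
    (fun _ _ _ => Prop_irrelevance _ _)
    (fun _ _ _ => Prop_irrelevance _ _)
    (fun _ _ _ _ _ _ _ => Prop_irrelevance _ _).

Definition wo_cat (W : wellorder) : small_category :=
  SmallCategory (wle_category_on (fun w : W => w)).

Definition below_cat (W : wellorder) (w : W) : small_category :=
  SmallCategory (wle_category_on (fun v : {v : W | wlt v w} => sval v)).

Section Sequences.
Variables (C : category) (W : wellorder) (X : functor (wo_cat W) C).

Definition restrict_below (w : W) : functor (below_cat w) C :=
  @Functor (below_cat w) C (fun v => X (sval v))
    (fun u v h => @fmap _ _ X (sval u) (sval v) h)
    (fun v => fmap_id X (sval v))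
    (fun u v x g f => @fmap_comp _ _ X (sval u) (sval v) (sval x) g f).

Lemma cocone_below_nat (w : W) (u v : below_cat w) (h : mor u v)
    (hu : wle (sval u) w) (hv : wle (sval v) w) :
  @fmap _ _ X (sval v) w hv ∘ fmap (restrict_below w) h
    = @fmap _ _ X (sval u) w hu.
Proof.
rewrite -(@fmap_comp _ _ X (sval u) (sval v) w hv h).
by congr (@fmap _ _ X _ _ _); exact: (@Prop_irrelevance (wle (sval u) w)).
Qed.

Definition cocone_below (w : W) : cocone (restrict_below w) (X w) :=
  @Cocone _ C (restrict_below w) (X w)
    (fun v => @fmap _ _ X (sval v) w (or_intror (svalP v)))
    (fun u v h => cocone_below_nat h _ _).

Definition limit_elt (w : W) : Prop :=
  (exists v, wlt v w) /\ (forall v, wlt v w -> exists2 u, wlt v u & wlt u w).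

Definition covers (v w : W) : Prop :=
  wlt v w /\ ~ (exists u, wlt v u /\ wlt u w).

Definition is_lambda_sequence : Prop :=
  forall w : W, limit_elt w -> is_colimit (cocone_below w).

Definition steps_in (D : mor_class C) : Prop :=
  forall (v w : wo_cat W) (h : mor v w), covers v w -> D _ _ (fmap X h).

End Sequences.

Inductive transfinite_composition (C : category) (D : mor_class C) :
    mor_class C :=
  TransfiniteComposition (W : wellorder) (X : functor (wo_cat W) C)
    (bot : wo_cat W) (L : C) (c : cocone X L) :
    (forall w : W, wle bot w) -> is_lambda_sequence X -> steps_in X D ->
    is_colimit c -> transfinite_composition D (cocone_leg c bot).

Record arrow (C : category) := Arrow {
  arr_dom : C;
  arr_cod : C;
  arr :> mor arr_dom arr_cod
}.

Definition pushout_class (C : category) (K : small_type) (I : K -> arrow C) :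
    mor_class C :=
  fun a b g => exists k (u : mor (arr_dom (I k)) a) (v : mor (arr_cod (I k)) b),
    is_pushout (I k) u v g.

Definition cell_class (C : category) (K : small_type) (I : K -> arrow C) :
    mor_class C := transfinite_composition (pushout_class I).

Definition rlp_class (C : category) (K : small_type) (I : K -> arrow C) :
    mor_class C := fun a b g => forall k, lifts (I k) g.

(** [W] is a limit ordinal, and every family of elements of [W] indexed by the
    cardinal [K] is bounded in [W]. *)
Definition card_filtered (K : small_type) (W : wellorder) : Prop :=
  [/\ exists w : W, True,
      forall v : W, exists w, wlt v w
    & forall f : K -> W, exists w, forall k, wle (f k) w].

(** The last two clauses say that [colim_w mor A (X w) -> mor A L] is
    surjective and injective. *)
Definition small_relative (C : category) (A : C) (D : mor_class C) : Prop :=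
  exists K : small_type, forall W : wellorder, card_filtered K W ->
  forall X : functor (wo_cat W) C, is_lambda_sequence X -> steps_in X D ->
  forall (L : C) (c : cocone X L), is_colimit c ->
    (forall f : mor A L, exists (w : W) (g : mor A (X w)),
      f = cocone_leg c w ∘ g) /\
    (forall (v w : wo_cat W) (g : mor A (X v)) (g' : mor A (X w)),
      cocone_leg c v ∘ g = cocone_leg c w ∘ g' ->
      exists (x : wo_cat W) (hv : mor v x) (hw : mor w x),
        fmap X hv ∘ g = fmap X hw ∘ g').

(** M. Hovey, Model categories, Definition 2.1.17. *)
Definition cofibrantly_generated (C : category) (M : model_structure C)
    (K K' : small_type) (I : K -> arrow C) (J : K' -> arrow C) : Prop :=
  [/\ forall k, small_relative (arr_dom (I k)) (cell_class I),
      forall k, small_relative (arr_dom (J k)) (cell_class J),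
      forall (a b : C) (f : mor a b), fib M f <-> rlp_class J f
    & forall (a b : C) (f : mor a b),
        (fib M f /\ weq M f) <-> rlp_class I f].

Section Modules.
Variable R : pzRingType.

Lemma linear_ext (U V : lmodType R) (f g : {linear U -> V}) : f =1 g -> f = g.
Proof.
case: f g => [f cf] [g cg] /= /funext fg; case: _ / fg cg => cg.
by congr GRing.Linear.Pack; move: cf cg => [[a] [b]] [[a'] [b']];
  rewrite (Prop_irrelevance a a') (Prop_irrelevance b b').
Qed.

Section Submodule.
Variables (V : lmodType R) (S : {pred V}) (cS : submod_closed S).

Definition submod_pred of submod_closed S : {pred V} := S.

HB.instance Definition _ := GRing.isSubmodClosed.Build R V (submod_pred cS)
  (GRing.submod_closed_semi cS).

Record submod := Submod {
  submod_val :> V;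
  submod_valP : submod_val \in submod_pred cS
}.

HB.instance Definition _ := [isSub for submod_val].
HB.instance Definition _ := [Choice of submod by <:].
HB.instance Definition _ := [SubChoice_isSubLmodule of submod by <:].

Lemma submod_val_linear : linear submod_val.
Proof. exact: (@linearP _ _ _ _ (val : {linear submod -> V})). Qed.
HB.instance Definition _ :=
  GRing.isLinear.Build R submod V *:%R submod_val submod_val_linear.

End Submodule.

Section Quotient.
Variables (V : lmodType R) (S : {pred V}) (cS : submod_closed S).

Definition quotmod := Quotient.quot (submod_pred cS).
HB.instance Definition _ := GRing.Zmodule.on quotmod.

Definition quotmod_pi (x : V) : quotmod := \pi_(Quotient.quot (submod_pred cS)) x.
Definition quotmod_scale (a : R) (q : quotmod) : quotmod :=
  quotmod_pi (a *: repr (q : Quotient.quot (submod_pred cS))).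

Lemma quotmod_piE (x y : V) : (quotmod_pi x == quotmod_pi y) = (x - y \in S).
Proof. by rewrite /quotmod_pi -Quotient.idealrBE. Qed.

Lemma quotmod_ind (P : quotmod -> Prop) :
  (forall x, P (quotmod_pi x)) -> forall q, P q.
Proof.
move=> h q; rewrite -[q](@reprK _ (Quotient.quot (submod_pred cS))).
exact: h.
Qed.

Lemma quotmod_piD (x y : V) :
  quotmod_pi (x + y) = quotmod_pi x + quotmod_pi y.
Proof. exact: raddfD. Qed.

Lemma quotmod_piZ (a : R) (x : V) :
  quotmod_pi (a *: x) = quotmod_scale a (quotmod_pi x).
Proof.
apply/eqP; rewrite /quotmod_scale quotmod_piE -scalerBr.
suff: x - repr (quotmod_pi x : Quotient.quot (submod_pred cS)) \in submod_pred cS.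
  exact: rpredZ.
by rewrite Quotient.idealrBE reprK.
Qed.

Fact quotmod_scalerA a b q :
  quotmod_scale a (quotmod_scale b q) = quotmod_scale (a * b) q.
Proof.
by elim/quotmod_ind: q => x; rewrite -!quotmod_piZ scalerA.
Qed.
Fact quotmod_scale1r : left_id 1 quotmod_scale.
Proof. by elim/quotmod_ind => x; rewrite -!quotmod_piZ scale1r. Qed.
Fact quotmod_scalerDr : right_distributive quotmod_scale +%R.
Proof.
move=> a p q; elim/quotmod_ind: p => x; elim/quotmod_ind: q => y.
by rewrite -quotmod_piD -!quotmod_piZ -quotmod_piD scalerDr.
Qed.
Fact quotmod_scalerDl q :
  {morph quotmod_scale^~ q : a b / a + b >-> a + b}.
Proof.
move=> a b; elim/quotmod_ind: q => x.
by rewrite -!quotmod_piZ -quotmod_piD scalerDl.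
Qed.
HB.instance Definition _ := GRing.Zmodule_isLmodule.Build R quotmod
  quotmod_scalerA quotmod_scale1r quotmod_scalerDr quotmod_scalerDl.

Lemma quotmod_pi_linear : linear quotmod_pi.
Proof. by move=> a x y; rewrite quotmod_piD quotmod_piZ. Qed.

End Quotient.

Section Homology.
Variables (U V W : lmodType R) (f : {linear U -> V}) (g : {linear V -> W}).

Definition ker_pred : {pred V} := fun x => g x == 0.

Lemma ker_pred_closed : submod_closed ker_pred.
Proof.
split=> [|a x y]; rewrite !unfold_in ?linear0 // => /eqP gx /eqP gy.
by rewrite linearP gx gy scaler0 addr0.
Qed.

Definition ker_mod := submod ker_pred_closed.
HB.instance Definition _ := GRing.Lmodule.on ker_mod.

Definition im_pred : {pred ker_mod} :=
  fun x => `[< exists u : U, f u = submod_val x >].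

Lemma im_pred_closed : submod_closed im_pred.
Proof.
split=> [|a x y]; rewrite !unfold_in.
  by apply/asboolP; exists 0; rewrite linear0.
move=> /asboolP[u fu] /asboolP[v fv]; apply/asboolP.
by exists (a *: u + v); rewrite linearP fu fv.
Qed.

(** This is [ker g / im f] only when [g \o f = 0]. *)
Definition homology := quotmod im_pred_closed.
HB.instance Definition _ := GRing.Lmodule.on homology.

Definition homology_class (x : ker_mod) : homology := quotmod_pi im_pred_closed x.

Definition homology_repr (c : homology) : ker_mod :=
  repr (c : Quotient.quot (submod_pred im_pred_closed)).

Lemma homology_reprK c : homology_class (homology_repr c) = c.
Proof. exact: (@reprK _ (Quotient.quot (submod_pred im_pred_closed))). Qed.

End Homology.
End Modules.

Section Bigraded.
Variables (R : comPzRingType) (r : nat).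

(** The differential takes both its source and its target bidegree as
    arguments, together with proofs that they are related by [(-r, 1 - r)]:
    this avoids transports along equalities in [int]. *)
Record bigraded_complex := BigradedComplex {
  bg_mod :> int -> int -> lmodType R;
  bg_d : forall i j i' j' : int, i' = i - r%:Z -> j' = j + 1 - r%:Z ->
    {linear bg_mod i j -> bg_mod i' j'};
  bg_dd : forall (i j i' j' i'' j'' : int)
    (ei : i' = i - r%:Z) (ej : j' = j + 1 - r%:Z)
    (ei' : i'' = i' - r%:Z) (ej' : j'' = j' + 1 - r%:Z) (x : bg_mod i j),
    bg_d ei' ej' (bg_d ei ej x) = 0
}.

Record bigraded_hom (K L : bigraded_complex) := BigradedHom {
  bg_hom :> forall i j : int, {linear K i j -> L i j};
  bg_homP : forall (i j i' j' : int) (ei : i' = i - r%:Z)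
    (ej : j' = j + 1 - r%:Z) (x : K i j),
    bg_hom i' j' (bg_d K ei ej x) = bg_d L ei ej (bg_hom i j x)
}.

Lemma bg_in_i (i : int) : i = i + r%:Z - r%:Z.
Proof. by rewrite addrK. Qed.

Lemma bg_in_j (j : int) : j = (j - 1 + r%:Z) + 1 - r%:Z.
Proof. by rewrite addrAC addrK subrK. Qed.

Definition bg_cocycles (K : bigraded_complex) (i j : int) : lmodType R :=
  ker_mod (@bg_d K i j _ _ erefl erefl).

Definition bg_cohomology (K : bigraded_complex) (i j : int) : lmodType R :=
  homology (bg_d K (bg_in_i i) (bg_in_j j)) (@bg_d K i j _ _ erefl erefl).

Definition bg_class (K : bigraded_complex) (i j : int) (x : bg_cocycles K i j) :
    bg_cohomology K i j :=
  homology_class (bg_d K (bg_in_i i) (bg_in_j j)) x.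

Lemma bg_classE (K : bigraded_complex) (i j : int) (x y : bg_cocycles K i j) :
  bg_class x = bg_class y <->
  exists u : K (i + r%:Z) (j - 1 + r%:Z),
    bg_d K (bg_in_i i) (bg_in_j j) u = submod_val x - submod_val y.
Proof.
have E : (bg_class x == bg_class y) = 
    (x - y \in @im_pred _ _ _ _ (bg_d K (bg_in_i i) (bg_in_j j)) _).
  exact: quotmod_piE.
split=> [/eqP|[u du]].
  by rewrite E => /asboolP[u du]; exists u; rewrite du raddfB.
by apply/eqP; rewrite E; apply/asboolP; exists u; rewrite du raddfB.
Qed.

Lemma bg_class_linear (K : bigraded_complex) (i j : int) :
  linear (@bg_class K i j).
Proof. exact: quotmod_pi_linear. Qed.

Section Induced.
Variables (K L : bigraded_complex) (f : bigraded_hom K L) (i j : int).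

Lemma bg_cocycle_mapP (x : bg_cocycles K i j) :
  f i j (submod_val x) \in
    submod_pred (ker_pred_closed (@bg_d L i j _ _ erefl erefl)).
Proof.
have /eqP dx := submod_valP x.
by rewrite unfold_in; apply/eqP; rewrite -bg_homP dx linear0.
Qed.

Definition bg_cocycle_map (x : bg_cocycles K i j) : bg_cocycles L i j :=
  Submod (bg_cocycle_mapP x).

Definition bg_cohomology_map (c : bg_cohomology K i j) : bg_cohomology L i j :=
  bg_class (bg_cocycle_map (homology_repr c)).

Lemma bg_cohomology_mapE (x : bg_cocycles K i j) :
  bg_cohomology_map (bg_class x) = bg_class (bg_cocycle_map x).
Proof.
have /bg_classE[u du] : bg_class (homology_repr (bg_class x)) = bg_class x.
  exact: homology_reprK.
by apply/bg_classE; exists (f _ _ u); rewrite -bg_homP du raddfB.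
Qed.

Lemma bg_cohomology_map_linear : linear bg_cohomology_map.
Proof.
move=> a c c'; rewrite -[c]homology_reprK -[c']homology_reprK.
rewrite -!/(bg_class _); set x := homology_repr c; set y := homology_repr c'.
rewrite -bg_class_linear !bg_cohomology_mapE -bg_class_linear.
by congr (bg_class _); apply/val_inj; rewrite /= linearP.
Qed.

End Induced.

Definition bg_quasi_iso (K L : bigraded_complex) (f : bigraded_hom K L) : Prop :=
  forall i j : int, bijective (@bg_cohomology_map K L f i j).

End Bigraded.

Section Filtered.
Variable R : comPzRingType.

(** As for [bg_d], the differential takes its source and target degrees as
    arguments. *)
Record filtered_complex := FilteredComplex {
  fc_mod :> int -> lmodType R;
  fc_d : forall n m : int, m = n + 1 -> {linear fc_mod n -> fc_mod m};
  fc_dd : forall (n m l : int) (e : m = n + 1) (e' : l = m + 1) (x : fc_mod n),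
    fc_d e' (fc_d e x) = 0;
  fc_F : forall p n : int, {pred fc_mod n};
  fc_F_closed : forall p n : int, submod_closed (@fc_F p n);
  fc_F_incr : forall (p n : int) (x : fc_mod n),
    x \in @fc_F (p - 1) n -> x \in @fc_F p n;
  fc_dF : forall (p n m : int) (e : m = n + 1) (x : fc_mod n),
    x \in @fc_F p n -> fc_d e x \in @fc_F p m
}.

Arguments fc_F : clear implicits.

Record fc_hom (A B : filtered_complex) := FCHom {
  fc_map :> forall n : int, {linear A n -> B n};
  fc_map_d : forall (n m : int) (e : m = n + 1) (x : A n),
    fc_map m (fc_d A e x) = fc_d B e (fc_map n x);
  fc_map_F : forall (p n : int) (x : A n),
    x \in fc_F A p n -> fc_map n x \in fc_F B p n
}.

Lemma fc_hom_ext (A B : filtered_complex) (f g : fc_hom A B) :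
  (forall n, f n =1 g n) -> f = g.
Proof.
case: f g => [f fd fF] [g gd gF] /= fg.
have {}fg : f = g.
  exact: functional_extensionality_dep (fun n => linear_ext (fg n)).
case: _ / fg gd gF => gd gF.
by rewrite (Prop_irrelevance fd gd) (Prop_irrelevance fF gF).
Qed.

Section Compose.

Definition fc_id (A : filtered_complex) : fc_hom A A :=
  @FCHom A A (fun n => idfun : {linear A n -> A n})
    (fun _ _ _ _ => erefl) (fun _ _ _ h => h).

Variables (A B C : filtered_complex) (g : fc_hom B C) (f : fc_hom A B).

Lemma fc_comp_d (n m : int) (e : m = n + 1) (x : A n) :
  (g m \o f m) (fc_d A e x) = fc_d C e ((g n \o f n) x).
Proof. by rewrite /= !fc_map_d. Qed.

Lemma fc_comp_F (p n : int) (x : A n) :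
  x \in fc_F A p n -> (g n \o f n) x \in fc_F C p n.
Proof. by move=> xF; do 2!apply: fc_map_F. Qed.

Definition fc_comp : fc_hom A C :=
  @FCHom A C (fun n => g n \o f n : {linear A n -> C n}) fc_comp_d fc_comp_F.

End Compose.

Lemma fc_comp1m (A B : filtered_complex) (f : fc_hom A B) :
  fc_comp (fc_id B) f = f.
Proof. exact: fc_hom_ext. Qed.

Lemma fc_compm1 (A B : filtered_complex) (f : fc_hom A B) :
  fc_comp f (fc_id A) = f.
Proof. exact: fc_hom_ext. Qed.

Lemma fc_compA (A B C D : filtered_complex) (h : fc_hom C D) (g : fc_hom B C)
    (f : fc_hom A B) :
  fc_comp h (fc_comp g f) = fc_comp (fc_comp h g) f.
Proof. exact: fc_hom_ext. Qed.

Definition FC : category :=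
  Category (CategoryOn fc_comp1m fc_compm1 fc_compA).

(** The component of [Z_r A] in bidegree [(i, j)] is [Z_r^{i,j}], so that
   [i] is the weight [p] and [j - i] is the degree [n]. *)

Section Zr.
Variable r : nat.

Section Object.
Variable A : filtered_complex.

Definition Zr_pred (i j : int) : {pred A (j - i)} := fun x =>
  (x \in fc_F A i (j - i)) &&
  (@fc_d A (j - i) _ erefl x \in fc_F A (i - r%:Z) (j - i + 1)).

Arguments Zr_pred : clear implicits.

Lemma Zr_predE (i j m : int) (e : m = j - i + 1) (x : A (j - i)) :
  x \in Zr_pred i j
    = (x \in fc_F A i (j - i)) && (fc_d A e x \in fc_F A (i - r%:Z) m).
Proof. by subst m. Qed.

Lemma Zr_pred_closed (i j : int) : submod_closed (Zr_pred i j).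
Proof.
have [F0 FD] := fc_F_closed A i (j - i).
have [G0 GD] := fc_F_closed A (i - r%:Z) (j - i + 1).
split=> [|a x y]; rewrite !(Zr_predE erefl) ?linear0 ?F0 ?G0 //.
by move=> /andP[xF xG] /andP[yF yG]; rewrite FD //= linearP GD.
Qed.

Definition Zr_mod (i j : int) : lmodType R := submod (Zr_pred_closed i j).

Lemma Zr_degree (i j i' j' : int) :
  i' = i - r%:Z -> j' = j + 1 - r%:Z -> j' - i' = j - i + 1.
Proof.
by move=> -> ->; rewrite opprB addrA subrK addrAC.
Qed.

Lemma Zr_dP (i j i' j' : int) (ei : i' = i - r%:Z) (ej : j' = j + 1 - r%:Z)
    (x : Zr_mod i j) :
  fc_d A (Zr_degree ei ej) (submod_val x) \in
    submod_pred (Zr_pred_closed i' j').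
Proof.
have := submod_valP x.
rewrite /submod_pred (Zr_predE (Zr_degree ei ej)) => /andP[_ dxF].
rewrite (Zr_predE erefl) fc_dd; move: dxF; rewrite -ei => -> /=.
by have [] := fc_F_closed A (i' - r%:Z) (j' - i' + 1).
Qed.

Definition Zr_d_fun (i j i' j' : int) (ei : i' = i - r%:Z)
    (ej : j' = j + 1 - r%:Z) (x : Zr_mod i j) : Zr_mod i' j' :=
  Submod (Zr_dP ei ej x).

Lemma Zr_d_linear (i j i' j' : int) (ei : i' = i - r%:Z)
    (ej : j' = j + 1 - r%:Z) : linear (Zr_d_fun ei ej).
Proof. by move=> a x y; apply/val_inj; rewrite /= linearP. Qed.

HB.instance Definition _ (i j i' j' : int) (ei : i' = i - r%:Z)
    (ej : j' = j + 1 - r%:Z) :=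
  GRing.isLinear.Build R (Zr_mod i j) (Zr_mod i' j') *:%R (Zr_d_fun ei ej)
    (Zr_d_linear ei ej).

Lemma Zr_dd (i j i' j' i'' j'' : int)
    (ei : i' = i - r%:Z) (ej : j' = j + 1 - r%:Z)
    (ei' : i'' = i' - r%:Z) (ej' : j'' = j' + 1 - r%:Z) (x : Zr_mod i j) :
  Zr_d_fun ei' ej' (Zr_d_fun ei ej x) = 0.
Proof. by apply/val_inj; rewrite /= fc_dd. Qed.

Definition Zr : bigraded_complex R r :=
  @BigradedComplex R r Zr_mod
    (fun i j i' j' ei ej => Zr_d_fun ei ej : {linear _ -> _}) Zr_dd.

End Object.

Section Morphism.
Variables (A B : filtered_complex) (f : fc_hom A B).

Lemma Zr_mapP (i j : int) (x : Zr_mod A i j) :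
  f (j - i) (submod_val x) \in submod_pred (Zr_pred_closed B i j).
Proof.
have := submod_valP x.
rewrite /submod_pred !(Zr_predE erefl) -fc_map_d => /andP[xF dxF].
by rewrite !fc_map_F.
Qed.

Definition Zr_map_fun (i j : int) (x : Zr_mod A i j) : Zr_mod B i j :=
  Submod (Zr_mapP x).

Lemma Zr_map_linear (i j : int) : linear (@Zr_map_fun i j).
Proof. by move=> a x y; apply/val_inj; rewrite /= linearP. Qed.

HB.instance Definition _ (i j : int) :=
  GRing.isLinear.Build R (Zr_mod A i j) (Zr_mod B i j) *:%R
    (@Zr_map_fun i j) (@Zr_map_linear i j).

Lemma Zr_map_d (i j i' j' : int) (ei : i' = i - r%:Z)
    (ej : j' = j + 1 - r%:Z) (x : Zr_mod A i j) :
  Zr_map_fun (Zr_d_fun ei ej x) = Zr_d_fun ei ej (Zr_map_fun x).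
Proof. by apply/val_inj; rewrite /= fc_map_d. Qed.

Definition Zr_map : bigraded_hom (Zr A) (Zr B) :=
  @BigradedHom R r (Zr A) (Zr B)
    (fun i j => @Zr_map_fun i j : {linear _ -> _}) Zr_map_d.

End Morphism.

Definition Zr_quasi_iso (A B : FC) (f : mor A B) : Prop :=
  bg_quasi_iso (Zr_map f).

Definition Zr_surjective (A B : FC) (f : mor A B) : Prop :=
  forall (i j : int) (y : Zr B i j), exists x : Zr A i j, Zr_map f i j x = y.

End Zr.

(** [R] if [b], and [0] otherwise. *)
Definition Rif (b : bool) : lmodType R :=
  if b then (R^o : lmodType R) else ('rV[R]_0 : lmodType R).

(** The identity of [R] if [b && c], and zero otherwise. *)
Definition Rif_map (b c : bool) : {linear Rif b -> Rif c} :=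
  match b as b, c as c return {linear Rif b -> Rif c} with
  | true, true => idfun : {linear R^o -> R^o}
  | _, _ => \0
  end.

Lemma Rif_map0 (b c : bool) (x : Rif b) : ~~ (b && c) -> Rif_map b c x = 0.
Proof. by case: b c x => [] []. Qed.

Lemma Rif_map_comp0 (b c d : bool) (x : Rif b) :
  ~~ [&& b, c & d] -> Rif_map c d (Rif_map b c x) = 0.
Proof. by case: b c d x => [] [] [] //= x _; rewrite ?linear0. Qed.

(** Given [s : int -> bool] and [w : int -> int], the filtered module which is
    [R] in the degrees satisfying [s], pure of weight [w n] in degree [n]. *)
Definition pure_F (s : int -> bool) (w : int -> int) (p n : int) :
    {pred Rif (s n)} := fun x => (w n <= p) || (x == 0).
Arguments pure_F : clear implicits.

Lemma pure_F_closed (s : int -> bool) (w : int -> int) (p n : int) :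
  submod_closed (pure_F s w p n).
Proof.
split=> [|a x y]; rewrite !unfold_in ?eqxx ?orbT //.
by case: (w n <= p) => //= /eqP -> /eqP ->; rewrite scaler0 addr0.
Qed.

Lemma pure_F_incr (s : int -> bool) (w : int -> int) (p n : int)
    (x : Rif (s n)) :
  x \in pure_F s w (p - 1) n -> x \in pure_F s w p n.
Proof.
rewrite !unfold_in => /orP[wp|->]; last by rewrite orbT.
by rewrite (le_trans wp) // gerDl.
Qed.

(** [R^n_(p)]. *)
Section Pure.
Variables p n : int.

Let s (m : int) := m == n.
Let w (_ : int) := p.

Definition pure_complex : FC :=
  @FilteredComplex (fun m => Rif (s m))
    (fun m l _ => \0 : {linear Rif (s m) -> Rif (s l)})
    (fun _ _ _ _ _ _ => erefl)
    (fun q m => pure_F s w q m) (@pure_F_closed s w) (@pure_F_incr s w)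
    (fun q m l _ _ _ => proj1 (pure_F_closed s w q l)).
End Pure.

(** [Z_r(p,n)]: the differential is the identity of [R] from degree [n] to
    degree [n + 1], and (necessarily) zero elsewhere. *)
Section ZrComplex.
Variables (r : nat) (p n : int).

Let s (m : int) := (m == n) || (m == n + 1).
Let w (m : int) := if m == n then p else p - r%:Z.

Let s_step (m l : int) : l = m + 1 -> s m -> s l -> m = n.
Proof. by rewrite /s; lia. Qed.

Lemma Zr_complex_dd (m l k : int) (e : l = m + 1) (e' : k = l + 1)
    (x : Rif (s m)) : Rif_map (s l) (s k) (Rif_map (s m) (s l) x) = 0.
Proof.
apply: Rif_map_comp0; apply/and3P => -[sm sl sk].
by have := s_step e sm sl; have := s_step e' sl sk; lia.
Qed.

Lemma Zr_complex_dF (q m l : int) (e : l = m + 1) (x : Rif (s m)) :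
  x \in pure_F s w q m -> Rif_map (s m) (s l) x \in pure_F s w q l.
Proof.
have [/andP[sm sl]|/Rif_map0 E _] := boolP (s m && s l); last first.
  by rewrite unfold_in E eqxx orbT.
have mn := s_step e sm sl; rewrite !unfold_in.
case/orP => [wq|/eqP ->]; last by rewrite linear0 eqxx orbT.
by apply/orP; left; move: wq; rewrite /w; do 2!case: eqP; lia.
Qed.

Definition Zr_complex : FC :=
  @FilteredComplex (fun m => Rif (s m))
    (fun m l _ => Rif_map (s m) (s l)) Zr_complex_dd
    (fun q m => pure_F s w q m) (@pure_F_closed s w) (@pure_F_incr s w)
    Zr_complex_dF.

Lemma Zr_incl_d (m l : int) (e : l = m + 1)
    (x : (pure_complex (p - r%:Z) (n + 1) : filtered_complex) m) :
  Rif_map (l == n + 1) (s l) (fc_d (pure_complex (p - r%:Z) (n + 1)) e x)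
    = fc_d Zr_complex e (Rif_map (m == n + 1) (s m) x).
Proof.
rewrite /= linear0 Rif_map_comp0 //; apply/and3P => -[/eqP mn sm sl].
by have := s_step e sm sl; lia.
Qed.

Lemma Zr_incl_F (q m : int)
    (x : (pure_complex (p - r%:Z) (n + 1) : filtered_complex) m) :
  x \in fc_F (pure_complex (p - r%:Z) (n + 1)) q m ->
  Rif_map (m == n + 1) (s m) x \in fc_F Zr_complex q m.
Proof.
rewrite !unfold_in => /orP[wq|/eqP ->]; last by rewrite linear0 eqxx orbT.
have [mn|mn] := pselect (m = n + 1); last first.
  by rewrite Rif_map0 ?eqxx ?orbT //; apply/andP => -[/eqP].
by apply/orP; left; rewrite /w ifF //; apply/eqP; lia.
Qed.

Definition Zr_incl : fc_hom (pure_complex (p - r%:Z) (n + 1)) Zr_complex :=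
  @FCHom (pure_complex (p - r%:Z) (n + 1)) Zr_complex
    (fun m => Rif_map (m == n + 1) (s m)) Zr_incl_d Zr_incl_F.

End ZrComplex.

Definition zero_complex : FC :=
  @FilteredComplex (fun=> 'rV[R]_0)
    (fun m l _ => \0 : {linear 'rV[R]_0 -> 'rV[R]_0})
    (fun _ _ _ _ _ _ => erefl) (fun _ _ => predT)
    (fun _ _ => conj isT (fun _ _ _ _ _ => isT))
    (fun _ _ _ _ => isT) (fun _ _ _ _ _ _ => isT).

Definition from_zero (A : FC) : fc_hom zero_complex A :=
  @FCHom zero_complex A
    (fun m => \0 : {linear 'rV[R]_0 -> (A : filtered_complex) m})
    (fun m l e _ => esym (linear0 (fc_d A e)))
    (fun q m _ _ => proj1 (fc_F_closed A q m)).

Definition I''_ (r : nat) (pn : int * int) : arrow FC :=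
  Arrow (Zr_incl r pn.1 pn.2 : mor (_ : FC) _).

Definition J''_ (r : nat) (pn : int * int) : arrow FC :=
  Arrow (from_zero (Zr_complex r pn.1 pn.2) : mor (_ : FC) _).

End Filtered.

(* Main.v *)
(** All the structure is visible on elements: a map [f : A -> B] lifts against
    [J''_r] iff [Z_r f] is surjective, and against [I''_r] iff each [y] in
    [F_p B] whose differential is the image of a cocycle [x] in [F_(p-r) A]
    lifts to an element of [F_p A] with differential [x]; the latter amounts to
    [Z_r f] being a surjective quasi-isomorphism.

    Both factorizations [A -> Q -> B] are obtained by taking for [Q] the initial
    factorization equipped with chosen lifts. Its left map lifts against any
    [g : X -> Y] with the same lifting property, since the pullback of [g] along
    [Q -> Y] is also such a factorization. If [i] lifts against the fibrations
    then, as every object is fibrant and has a path object, [i] is a homotopy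
    equivalence up to a homotopy of weight [r], hence a weak equivalence; the
    retract argument then gives the remaining lifting axiom. *)

From HB Require Import structures.
Require Import Defs.
From mathcomp Require Import all_boot all_order all_algebra.
From mathcomp Require Import boolp zify.

Set Implicit Arguments.
Unset Strict Implicit.
Unset Printing Implicit Defensive.

Import Order.TTheory GRing.Theory Num.Theory.
Local Open Scope ring_scope.
Local Open Scope quotient_scope.
Local Open Scope cat_scope.

Arguments fc_F {R} _ _ _ _ : simpl never.

(** The shifts by [r] all come from one fact: the cohomology of [Z_r] in weight [p] consists of the
    cocycles of [F_p] modulo [d(F_(p+r))]. A homotopy that raises weights by at most [r] is
    therefore invisible to it, which dictates the weights in the path object.

    The lifts in a factorization are chosen, not merely assumed to exist, because initiality needs
    operations that maps can preserve. These operations make sense on lifting problems only, so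
    terms must carry a side condition, and that condition must be meaningful before the initial
    object exists; reading it in all factorizations at once breaks the circle.

    Cofibrations are defined by their lifting property. The left map of a factorization then only
    has to be shown to lift, and no cellular description of it is needed. Cofibrant generation
    reduces to recognizing the two lifting classes and to the smallness of the domains. *)

Definition linear_of (R : pzRingType) (U V : lmodType R) (f : U -> V)
    (h : linear f) : {linear U -> V} :=
  HB.pack f (GRing.isLinear.Build R U V *:%R f h).

(** * Products of modules *)

Section ProductModule.
Variables (R : pzRingType) (I : small_type) (V : I -> lmodType R).

Definition prodmod : Type := forall i, V i.

HB.instance Definition _ := gen_eqMixin prodmod.
HB.instance Definition _ := gen_choiceMixin prodmod.

Let zero : prodmod := fun=> 0.
Let opp (x : prodmod) : prodmod := fun i => - x i.
Let add (x y : prodmod) : prodmod := fun i => x i + y i.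
Let scale (a : R) (x : prodmod) : prodmod := fun i => a *: x i.

Fact prodmod_addA : associative add.
Proof.
by move=> x y z; apply: functional_extensionality_dep => i; exact: addrA.
Qed.
Fact prodmod_addC : commutative add.
Proof.
by move=> x y; apply: functional_extensionality_dep => i; exact: addrC.
Qed.
Fact prodmod_add0 : left_id zero add.
Proof.
by move=> x; apply: functional_extensionality_dep => i; exact: add0r.
Qed.
Fact prodmod_addN : left_inverse zero opp add.
Proof.
by move=> x; apply: functional_extensionality_dep => i; exact: addNr.
Qed.
HB.instance Definition _ := GRing.isZmodule.Build prodmod
  prodmod_addA prodmod_addC prodmod_add0 prodmod_addN.

Fact prodmod_scaleA a b x : scale a (scale b x) = scale (a * b) x.
Proof. by apply: functional_extensionality_dep => i; exact: scalerA. Qed.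
Fact prodmod_scale1 : left_id 1 scale.
Proof.
by move=> x; apply: functional_extensionality_dep => i; exact: scale1r.
Qed.
Fact prodmod_scaleDr : right_distributive scale +%R.
Proof.
by move=> a x y; apply: functional_extensionality_dep => i; exact: scalerDr.
Qed.
Fact prodmod_scaleDl x : {morph scale^~ x : a b / a + b}.
Proof.
by move=> a b; apply: functional_extensionality_dep => i; exact: scalerDl.
Qed.
HB.instance Definition _ := GRing.Zmodule_isLmodule.Build R prodmod
  prodmod_scaleA prodmod_scale1 prodmod_scaleDr prodmod_scaleDl.

Lemma prodmodP a (x y : prodmod) i : (a *: x + y) i = a *: x i + y i.
Proof. by []. Qed.

Definition prodmod_proj (i : I) : {linear prodmod -> V i} :=
  linear_of (fun a x y => prodmodP a x y i).

End ProductModule.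

Section Complexes.
Variable R : comPzRingType.
Implicit Types A B C X Y : filtered_complex R.

Lemma fc_F0 A p n : (0 : A n) \in fc_F A p n.
Proof. by case: (fc_F_closed A p n). Qed.

Lemma fc_FP A p n a (x y : A n) :
  x \in fc_F A p n -> y \in fc_F A p n -> a *: x + y \in fc_F A p n.
Proof. by case: (fc_F_closed A p n) => _; apply. Qed.

Lemma fc_FD A p n (x y : A n) :
  x \in fc_F A p n -> y \in fc_F A p n -> x + y \in fc_F A p n.
Proof. by move=> xF yF; rewrite -[x]scale1r fc_FP. Qed.

Lemma fc_FB A p n (x y : A n) :
  x \in fc_F A p n -> y \in fc_F A p n -> x - y \in fc_F A p n.
Proof. by move=> xF yF; rewrite addrC -scaleN1r fc_FP. Qed.

Lemma fc_F_incr_nat A p n (k : nat) (x : A n) :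
  x \in fc_F A p n -> x \in fc_F A (p + k%:Z) n.
Proof.
elim: k => [|k IH] xF; first by rewrite addr0.
apply: fc_F_incr; rewrite -[k.+1]addn1 PoszD addrA addrK.
exact: IH.
Qed.

(** * Limits *)

Section Subcomplex.
Variables (A : filtered_complex R) (S : forall n, {pred A n})
  (G : forall p n : int, {pred A n}).
Hypothesis cS : forall n, submod_closed (@S n).
Hypothesis dS : forall n m (e : m = n + 1) (x : A n),
  x \in @S n -> fc_d A e x \in @S m.
Hypothesis cG : forall p n, submod_closed (@G p n).
Hypothesis G_incr : forall p n (x : A n), x \in @G (p - 1) n -> x \in @G p n.
Hypothesis dG : forall p n m (e : m = n + 1) (x : A n),
  x \in @G p n -> fc_d A e x \in @G p m.

Let M n : lmodType R := submod (cS n).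

Definition subc_d_fun n m (e : m = n + 1) (x : M n) : M m :=
  Submod (dS e (submod_valP x) : _ \in submod_pred (cS m)).

Lemma subc_d_linear n m (e : m = n + 1) : linear (subc_d_fun e).
Proof. by move=> a x y; apply/val_inj; rewrite /= linearP. Qed.

Lemma subc_dd n m l (e : m = n + 1) (e' : l = m + 1) (x : M n) :
  subc_d_fun e' (subc_d_fun e x) = 0.
Proof. by apply/val_inj; rewrite /= fc_dd. Qed.

Definition subc_F p n : {pred M n} := fun x => submod_val x \in @G p n.

Lemma subc_F_closed p n : submod_closed (@subc_F p n).
Proof.
have [G0 GP] := cG p n; split=> [|a x y xG yG]; first exact: G0.
rewrite -[_ \in _]/(submod_val (a *: x + y) \in @G p n) submod_val_linear.
exact: GP.
Qed.

(** The filtration [G] is a parameter because two uses differ: limits and pullbacks restrict the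
    ambient filtration, whereas the image of a sequential colimit carries the images of the
    filtrations of the stages, which could a priori be smaller. *)
Definition subcomplex : filtered_complex R :=
  @FilteredComplex R M (fun n m e => linear_of (subc_d_linear e)) subc_dd
    subc_F subc_F_closed (fun p n x => @G_incr p n (submod_val x))
    (fun p n m e x => @dG p n m e (submod_val x)).

Section Inclusion.
Hypothesis GF : forall p n (x : A n), x \in @G p n -> x \in fc_F A p n.

Definition subc_incl : fc_hom subcomplex A :=
  @FCHom R subcomplex A (fun n => linear_of (@submod_val_linear _ _ _ (cS n)))
    (fun _ _ _ _ => erefl) (fun p n x => @GF p n (submod_val x)).
End Inclusion.

Section Corestriction.
Variables (B : filtered_complex R) (f : fc_hom B A).
Hypothesis fS : forall n x, f n x \in @S n.
Hypothesis fG : forall p n x, x \in fc_F B p n -> f n x \in @G p n.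

Definition subc_cores_fun n (x : B n) : M n :=
  Submod (fS x : _ \in submod_pred (cS n)).

Lemma subc_cores_linear n : linear (@subc_cores_fun n).
Proof. by move=> a x y; apply/val_inj; rewrite /= linearP. Qed.

Lemma subc_cores_d n m (e : m = n + 1) (x : B n) :
  subc_cores_fun (fc_d B e x) = subc_d_fun e (subc_cores_fun x).
Proof. by apply/val_inj; rewrite /= fc_map_d. Qed.

Definition subc_cores : fc_hom B subcomplex :=
  @FCHom R B subcomplex (fun n => linear_of (@subc_cores_linear n))
    subc_cores_d fG.
End Corestriction.
End Subcomplex.

Section Product.
Variables (I : small_type) (A : I -> filtered_complex R).

Let M n : lmodType R := prodmod (fun i => A i n).

Definition prodc_d_fun n m (e : m = n + 1) (x : M n) : M m :=
  fun i => fc_d (A i) e (x i).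

Lemma prodc_d_linear n m (e : m = n + 1) : linear (prodc_d_fun e).
Proof.
by move=> a x y; apply: functional_extensionality_dep => i; exact: linearP.
Qed.

Lemma prodc_dd n m l (e : m = n + 1) (e' : l = m + 1) (x : M n) :
  prodc_d_fun e' (prodc_d_fun e x) = 0.
Proof. by apply: functional_extensionality_dep => i; exact: fc_dd. Qed.

Definition prodc_F p n : {pred M n} :=
  fun x => `[< forall i, x i \in fc_F (A i) p n >].

Lemma prodc_F_closed p n : submod_closed (@prodc_F p n).
Proof.
split=> [|a x y]; rewrite !unfold_in.
  by apply/asboolP => i; exact: fc_F0.
move=> /asboolP xF /asboolP yF; apply/asboolP => i.
by apply: fc_FP.
Qed.

Lemma prodc_F_incr p n (x : M n) :
  x \in @prodc_F (p - 1) n -> x \in @prodc_F p n.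
Proof. by move=> /asboolP xF; apply/asboolP => i; exact: fc_F_incr. Qed.

Lemma prodc_dF p n m (e : m = n + 1) (x : M n) :
  x \in @prodc_F p n -> prodc_d_fun e x \in @prodc_F p m.
Proof. by move=> /asboolP xF; apply/asboolP => i; exact: fc_dF. Qed.

Definition prodc : filtered_complex R :=
  @FilteredComplex R M (fun n m e => linear_of (prodc_d_linear e)) prodc_dd
    prodc_F prodc_F_closed prodc_F_incr prodc_dF.

Lemma prodc_proj_F i p n (x : M n) :
  x \in @prodc_F p n -> x i \in fc_F (A i) p n.
Proof. by move=> /asboolP. Qed.

Definition prodc_proj i : fc_hom prodc (A i) :=
  @FCHom R prodc (A i) (fun n => prodmod_proj (fun i => A i n) i)
    (fun _ _ _ _ => erefl) (prodc_proj_F i).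

Section Tuple.
Variables (B : filtered_complex R) (f : forall i, fc_hom B (A i)).

Definition prodc_tuple_fun n (x : B n) : M n := fun i => f i n x.

Lemma prodc_tuple_linear n : linear (@prodc_tuple_fun n).
Proof.
by move=> a x y; apply: functional_extensionality_dep => i; exact: linearP.
Qed.

Lemma prodc_tuple_d n m (e : m = n + 1) (x : B n) :
  prodc_tuple_fun (fc_d B e x) = prodc_d_fun e (prodc_tuple_fun x).
Proof. by apply: functional_extensionality_dep => i; exact: fc_map_d. Qed.

Lemma prodc_tuple_F p n (x : B n) :
  x \in fc_F B p n -> prodc_tuple_fun x \in @prodc_F p n.
Proof. by move=> xF; apply/asboolP => i; exact: fc_map_F. Qed.

Definition prodc_tuple : fc_hom B prodc :=
  @FCHom R B prodc (fun n => linear_of (@prodc_tuple_linear n))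
    prodc_tuple_d prodc_tuple_F.
End Tuple.
End Product.

Section Limits.
Variables (J : small_category) (F : functor J (FC R)).

Let P : filtered_complex R := @prodc (sob J) (fun j => F j).

Definition lim_pred n : {pred P n} := fun x =>
  `[< forall (j k : J) (u : mor j k), fmap F u n (x j) = x k >].

Lemma lim_pred_closed n : submod_closed (@lim_pred n).
Proof.
split=> [|a x y]; rewrite !unfold_in.
  by apply/asboolP => j k u; exact: linear0.
move=> /asboolP xL /asboolP yL; apply/asboolP => j k u.
by rewrite prodmodP linearP xL yL.
Qed.

Lemma lim_pred_d n m (e : m = n + 1) (x : P n) :
  x \in @lim_pred n -> fc_d P e x \in @lim_pred m.
Proof.
move=> /asboolP xL; apply/asboolP => j k u.
by rewrite fc_map_d xL.
Qed.

Definition lim_fc : FC R := subcomplex lim_pred_closed lim_pred_d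
  (fc_F_closed P) (@fc_F_incr R P) (@fc_dF R P).

Definition lim_incl : fc_hom lim_fc P :=
  subc_incl lim_pred_closed lim_pred_d
  (fc_F_closed P) (@fc_F_incr R P) (@fc_dF R P) (fun _ _ _ h => h).

Definition lim_leg (j : J) : fc_hom lim_fc (F j) :=
  fc_comp (@prodc_proj (sob J) (fun j => F j) j) lim_incl.

Lemma lim_leg_nat (j k : J) (u : mor j k) :
  fmap F u ∘ (lim_leg j : mor (lim_fc : FC R) _) = lim_leg k.
Proof.
by apply: fc_hom_ext => n x; have /asboolP := submod_valP x; apply.
Qed.

Definition lim_cone : cone F lim_fc := Cone lim_leg_nat.

Lemma lim_coneP : is_limit lim_cone.
Proof.
move=> L' c'; pose t := @prodc_tuple (sob J) (fun j => F j) L' (cone_leg c').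
have cS n (x : (L' : filtered_complex R) n) :
    t n x \in @lim_pred n.
  apply/asboolP => j k u.
  by rewrite -[t n x k]/(cone_leg c' k n x) -(cone_nat c' u).
exists (@subc_cores _ _ _ lim_pred_closed lim_pred_d
  (fc_F_closed P) (@fc_F_incr R P) (@fc_dF R P) L' t cS (fc_map_F t)).
split=> [j|h hc]; first exact: fc_hom_ext.
apply: fc_hom_ext => n x; apply/val_inj.
apply: functional_extensionality_dep => j.
exact: (congr1 (fun g : fc_hom L' (F j) => g n x) (esym (hc j))).
Qed.

End Limits.

Lemma FC_has_small_limits : has_small_limits (FC R).
Proof. by move=> J F; exists (lim_fc F), (lim_cone F); exact: lim_coneP. Qed.

End Complexes.

(** * Term models and colimits *)

(* The filtered complex presented by generators and partial operations, where
   [T] is the (large) type of algebras. A term is kept if all its operations are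
   applied within their domain in every algebra, and terms are identified, or
   given weight [p], when this holds in every algebra: as these conditions are
   propositions, quantifying over [T] does not raise the universe. *)
Section TermModel.
Variables (R : comPzRingType) (T : Type) (U : T -> filtered_complex R).
Variables (G : int -> small_type) (O : int -> int -> small_type).
Variables (gen : forall (c : T) n, G n -> U c n)
  (op : forall (c : T) n m, O n m -> U c m -> U c n)
  (valid : forall (c : T) n m, O n m -> U c m -> Prop).

Inductive term : int -> small_type :=
| Tgen n of G n : term n
| Tzero n : term n
| Tlin n of R & term n & term n : term n
| Td n m of m = n + 1 & term n : term m
| Top n m of O n m & term m : term n.

Fixpoint eval (c : T) n (t : term n) : U c n :=
  match t in term n return U c n with
  | Tgen n g => gen c g
  | Tzero n => 0
  | Tlin n a t u => a *: eval c t + eval c u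
  | Td n m e t => fc_d (U c) e (eval c t)
  | Top n m o t => op o (eval c t)
  end.

Fixpoint good n (t : term n) : Prop :=
  match t with
  | Tgen _ _ | Tzero _ => True
  | Tlin _ _ t u => good t /\ good u
  | Td _ _ _ t => good t
  | Top _ _ o t => good t /\ forall c, valid o (eval c t)
  end.

Record gterm n := GTerm { gterm_val :> term n; gtermP : good gterm_val }.

HB.instance Definition _ n := gen_eqMixin (gterm n).
HB.instance Definition _ n := gen_choiceMixin (gterm n).

Definition term_eqv n (t u : gterm n) : bool :=
  `[< forall c, eval c t = eval c u >].

Lemma term_eqv_equiv n : equiv_class_of (@term_eqv n).
Proof.
split=> [t|t u|u t v]; first exact/asboolP.
  by apply/asboolP/asboolP => h c.
by move=> /asboolP tu /asboolP uv; apply/asboolP => c; rewrite tu.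
Qed.

Canonical term_eqv_rel n := EquivRelPack (@term_eqv_equiv n).

Definition tmod n := {eq_quot (@term_eqv n)}.
HB.instance Definition _ n := Choice.on (tmod n).

Definition tm_eval c n (q : tmod n) : U c n := eval c (repr q : gterm n).
Definition tm_class n (t : gterm n) : tmod n := \pi t.

Lemma tm_evalE c n (t : gterm n) : tm_eval c (tm_class t) = eval c t.
Proof.
rewrite /tm_eval /tm_class.
have /eqmodP /asboolP /(_ c) // : repr (\pi_(tmod n) t) = t %[mod tmod n].
by rewrite reprK.
Qed.

Lemma tm_ext n (q q' : tmod n) :
  (forall c, tm_eval c q = tm_eval c q') -> q = q'.
Proof.
move=> h; rewrite -[q]reprK -[q']reprK.
by apply/eqmodP/asboolP => c; exact: h.
Qed.

Definition tm_zero n : tmod n := tm_class (@GTerm n (Tzero n) I).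
Definition tm_lin n (a : R) (q q' : tmod n) : tmod n :=
  tm_class (@GTerm n (Tlin a (repr q : gterm n) (repr q' : gterm n))
    (conj (gtermP _) (gtermP _))).
Definition tm_gen n (g : G n) : tmod n := tm_class (@GTerm n (Tgen g) I).
Definition tm_d n m (e : m = n + 1) (q : tmod n) : tmod m :=
  tm_class (@GTerm m (Td e (repr q : gterm n)) (gtermP _)).
Definition tm_op n m (o : O n m) (q : tmod m)
    (v : forall c, valid o (tm_eval c q)) : tmod n :=
  tm_class (@GTerm n (Top o (repr q : gterm m)) (conj (gtermP _) v)).

Lemma tm_eval0 c n : tm_eval c (tm_zero n) = 0.
Proof. exact: tm_evalE. Qed.

Lemma tm_eval_lin c n a (q q' : tmod n) :
  tm_eval c (tm_lin a q q') = a *: tm_eval c q + tm_eval c q'.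
Proof. exact: tm_evalE. Qed.

Definition tm_opp n (q : tmod n) := tm_lin (-1) q (tm_zero n).
Definition tm_add n (q q' : tmod n) := tm_lin 1 q q'.
Definition tm_scale n a (q : tmod n) := tm_lin a q (tm_zero n).

Fact tm_addA n : associative (@tm_add n).
Proof.
by move=> x y z; apply: tm_ext => c; rewrite !tm_eval_lin !scale1r addrA.
Qed.
Fact tm_addC n : commutative (@tm_add n).
Proof.
by move=> x y; apply: tm_ext => c; rewrite !tm_eval_lin !scale1r addrC.
Qed.
Fact tm_add0 n : left_id (tm_zero n) (@tm_add n).
Proof.
by move=> x; apply: tm_ext => c; rewrite tm_eval_lin tm_eval0 scale1r add0r.
Qed.
Fact tm_addN n : left_inverse (tm_zero n) (@tm_opp n) (@tm_add n).
Proof.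
move=> x; apply: tm_ext => c; rewrite !tm_eval_lin !tm_eval0.
by rewrite addr0 scale1r scaleN1r addNr.
Qed.
HB.instance Definition _ n := GRing.isZmodule.Build (tmod n)
  (@tm_addA n) (@tm_addC n) (@tm_add0 n) (@tm_addN n).

Lemma tm_evalD c n (x y : tmod n) :
  tm_eval c (x + y) = tm_eval c x + tm_eval c y.
Proof. by rewrite tm_eval_lin scale1r. Qed.
Lemma tm_evalZ c n a (x : tmod n) : tm_eval c (tm_scale a x) = a *: tm_eval c x.
Proof. by rewrite tm_eval_lin tm_eval0 addr0. Qed.

Fact tm_scaleA n a b (x : tmod n) :
  tm_scale a (tm_scale b x) = tm_scale (a * b) x.
Proof. by apply: tm_ext => c; rewrite !tm_evalZ scalerA. Qed.
Fact tm_scale1 n : left_id 1 (@tm_scale n).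
Proof. by move=> x; apply: tm_ext => c; rewrite !tm_evalZ scale1r. Qed.
Fact tm_scaleDr n : right_distributive (@tm_scale n) +%R.
Proof.
move=> a x y; apply: tm_ext => c.
by rewrite tm_evalD !tm_evalZ tm_evalD scalerDr.
Qed.
Fact tm_scaleDl n x : {morph (@tm_scale n)^~ x : a b / a + b}.
Proof.
by move=> a b; apply: tm_ext => c; rewrite tm_evalD !tm_evalZ scalerDl.
Qed.
HB.instance Definition _ n := GRing.Zmodule_isLmodule.Build R (tmod n)
  (@tm_scaleA n) (@tm_scale1 n) (@tm_scaleDr n) (@tm_scaleDl n).

Lemma tm_eval_linear c n : linear (@tm_eval c n).
Proof. by move=> a x y; rewrite tm_evalD tm_evalZ. Qed.

Lemma tm_eval_d c n m (e : m = n + 1) (q : tmod n) :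
  tm_eval c (tm_d e q) = fc_d (U c) e (tm_eval c q).
Proof. by rewrite tm_evalE. Qed.

Lemma tm_d_linear n m (e : m = n + 1) : linear (tm_d e).
Proof.
move=> a x y; apply: tm_ext => c.
by rewrite tm_eval_linear !tm_eval_d tm_eval_linear linearP.
Qed.

Lemma tm_dd n m l (e : m = n + 1) (e' : l = m + 1) (x : tmod n) :
  tm_d e' (tm_d e x) = 0.
Proof. by apply: tm_ext => c; rewrite [RHS]tm_eval0 !tm_eval_d fc_dd. Qed.

Definition tm_F (p n : int) : {pred tmod n} :=
  fun q => `[< forall c, tm_eval c q \in fc_F (U c) p n >].

Lemma tm_F_closed p n : submod_closed (@tm_F p n).
Proof.
split=> [|a x y]; first by apply/asboolP => c; rewrite tm_eval0 fc_F0.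
move=> /asboolP xF /asboolP yF; apply/asboolP => c.
by rewrite tm_eval_linear fc_FP.
Qed.

Lemma tm_F_incr p n (x : tmod n) : x \in @tm_F (p - 1) n -> x \in @tm_F p n.
Proof. by move=> /asboolP xF; apply/asboolP => i; exact: fc_F_incr. Qed.

Lemma tm_dF p n m (e : m = n + 1) (x : tmod n) :
  x \in @tm_F p n -> tm_d e x \in @tm_F p m.
Proof.
by move=> /asboolP xF; apply/asboolP => i; rewrite tm_eval_d; exact: fc_dF.
Qed.

Definition term_model : filtered_complex R :=
  @FilteredComplex R tmod (fun n m e => linear_of (@tm_d_linear n m e)) tm_dd
    tm_F tm_F_closed tm_F_incr tm_dF.

Lemma term_model_eval_F c p n (x : tmod n) :
  x \in @tm_F p n -> tm_eval c x \in fc_F (U c) p n.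
Proof. by move=> /asboolP. Qed.

Definition term_model_eval c : fc_hom term_model (U c) :=
  @FCHom R term_model (U c) (fun n => linear_of (@tm_eval_linear c n))
    (@tm_eval_d c) (term_model_eval_F c).

Definition term_model_gen n (g : G n) : term_model n := tm_gen g.
Definition term_model_op n m (o : O n m) (q : term_model m)
    (v : forall c, valid o (term_model_eval c m q)) : term_model n := tm_op v.

Lemma term_model_genE c n (g : G n) :
  term_model_eval c n (term_model_gen g) = gen c g.
Proof. exact: tm_evalE. Qed.

Lemma term_model_opE c n m (o : O n m) (q : term_model m) v :
  term_model_eval c n (@term_model_op n m o q v) = op o (term_model_eval c m q).
Proof. exact: tm_evalE. Qed.

Lemma term_model_ext n (q q' : term_model n) :
  (forall c, term_model_eval c n q = term_model_eval c n q') -> q = q'.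
Proof. exact: tm_ext. Qed.

Lemma term_model_F p n (q : term_model n) :
  q \in fc_F term_model p n <->
  forall c, term_model_eval c n q \in fc_F (U c) p n.
Proof. by split=> [/asboolP|h]; last exact/asboolP. Qed.

(** The representative chosen for a class need not be built from the representatives chosen for its
    parts. Each case of the induction on raw terms therefore compares the class of a term with the
    operation applied to classes, by evaluating both in every algebra. *)
Lemma term_model_ind (P : forall n, term_model n -> Prop) :
  (forall n (g : G n), P n (term_model_gen g)) ->
  (forall n, P n 0) ->
  (forall n a (x y : term_model n), P n x -> P n y -> P n (a *: x + y)) ->
  (forall n m (e : m = n + 1) (x : term_model n),
    P n x -> P m (fc_d term_model e x)) ->
  (forall n m (o : O n m) (q : term_model m) v,
    P m q -> P n (@term_model_op n m o q v)) ->
  forall n (q : term_model n), P n q.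
Proof.
move=> Pg P0 PP Pd Po n q; rewrite -[q]reprK -/(tm_class _).
case: (repr q : gterm n) => t gt {q}.
elim: t gt => {n} [n g []|n []|n a t IHt u IHu [gt gu]|n m e t IH gt
                  |n m o t IH [gt v]].
- exact: Pg.
- exact: P0.
- suff -> : tm_class (@GTerm n (Tlin a t u) (conj gt gu)) =
    a *: (tm_class (GTerm gt)) + (tm_class (GTerm gu)) :> term_model n.
    by apply: PP; [exact: IHt|exact: IHu].
  by apply: tm_ext => c; rewrite tm_eval_linear !tm_evalE.
- suff -> : tm_class (@GTerm m (Td e t) gt) =
    fc_d term_model e (tm_class (@GTerm n t gt) : term_model n) :> term_model m
    by apply: Pd; exact: IH.
  by apply: tm_ext => c; rewrite tm_eval_d !tm_evalE.
- have v' c : valid o (term_model_eval c m (tm_class (GTerm gt))).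
    by rewrite /= tm_evalE.
  suff -> : tm_class (@GTerm n (@Top n m o t) (conj gt v)) =
    term_model_op v' :> term_model n.
    by apply: Po; exact: IH.
  by apply: tm_ext => c; rewrite !tm_evalE /= -/(tm_eval _ _) tm_evalE.
Qed.

(** The uniqueness half of initiality. [D] need not be an algebra: it is enough that agreement at an
    argument passes to the result of the operation. *)
Lemma term_model_hom_ext (D : filtered_complex R) (f g : fc_hom term_model D) :
  (forall n (x : G n), f n (term_model_gen x) = g n (term_model_gen x)) ->
  (forall n m (o : O n m) (q : term_model m) v, f m q = g m q ->
    f n (@term_model_op n m o q v) = g n (@term_model_op n m o q v)) -> f = g.
Proof.
move=> fg fo; apply: fc_hom_ext; apply: term_model_ind => //.
- by move=> n; rewrite !linear0.
- by move=> n a x y fx fy; rewrite !linearP fx fy.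
- by move=> n m e x fx; rewrite !fc_map_d fx.
Qed.

End TermModel.

Arguments term_model_gen {R T U G O gen op valid n} g.
Arguments term_model_eval {R T U G O gen op valid} c.

(** * Colimits as term models over all cocones *)

Section Colimits.
Variables (R : comPzRingType) (J : small_category) (F : functor J (FC R)).

Record any_cocone := AnyCocone { ac_ob : FC R; ac_cocone : cocone F ac_ob }.

Let gens (n : int) : small_type := {j : sob J & (F j : filtered_complex R) n}.
Let ops (n m : int) : small_type := void.
Let gen (c : any_cocone) n (g : gens n) : (ac_ob c : filtered_complex R) n :=
  (cocone_leg (ac_cocone c) (tag g) : fc_hom _ _) n (tagged g).

(** The generators are the elements of all the [F j], and there are no operations. No relation is
    imposed by hand: linearity of the legs, their naturality and their compatibility with weights
    hold because they hold in every cocone. *)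
Definition colim_fc : FC R :=
  @term_model R any_cocone (fun c => ac_ob c) gens ops gen
    (fun c n m (o : ops n m) => match o with end)
    (fun c n m (o : ops n m) => match o with end).

Let inj (j : sob J) n (x : (F j : filtered_complex R) n) :
    (colim_fc : filtered_complex R) n :=
  term_model_gen (Tagged (fun j => (F j : filtered_complex R) n) x).

Let ev (c : any_cocone) : fc_hom colim_fc (ac_ob c) := term_model_eval c.

Let evE c j n (x : (F j : filtered_complex R) n) :
  ev c n (inj x) = (cocone_leg (ac_cocone c) j : fc_hom _ _) n x.
Proof. exact: term_model_genE. Qed.

Let inj_linear j n : linear (@inj j n).
Proof.
move=> a x y; apply: term_model_ext => c.
by rewrite -/(ev c) linearP !evE linearP.
Qed.

Let inj_d j n m (e : m = n + 1) (x : (F j : filtered_complex R) n) :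
  inj (fc_d (F j) e x) = fc_d colim_fc e (inj x).
Proof.
apply: term_model_ext => c.
by rewrite -/(ev c) fc_map_d !evE fc_map_d.
Qed.

Let inj_F j p n (x : (F j : filtered_complex R) n) :
  x \in fc_F (F j) p n -> inj x \in fc_F colim_fc p n.
Proof.
move=> xF; apply/term_model_F => c.
by rewrite -/(ev c) evE; exact: fc_map_F.
Qed.

Definition colim_leg (j : J) : mor (F j) colim_fc :=
  @FCHom R (F j) colim_fc (fun n => linear_of (@inj_linear j n))
    (@inj_d j) (@inj_F j).

Lemma colim_leg_nat (j k : J) (u : mor j k) :
  colim_leg k ∘ fmap F u = colim_leg j.
Proof.
apply: fc_hom_ext => n x; apply: term_model_ext => c.
apply: etrans (evE c _) _; apply: etrans _ (esym (evE c x)).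
exact: (congr1 (fun g : fc_hom (F j) (ac_ob c) => g n x)
  (cocone_nat (ac_cocone c) u)).
Qed.

Definition colim_cocone : cocone F colim_fc := Cocone colim_leg_nat.

Lemma colim_coconeP : is_colimit colim_cocone.
Proof.
move=> L' c'; exists (ev (AnyCocone c')); split=> [j|h hc].
  by apply: fc_hom_ext => n x; exact: (evE (AnyCocone c')).
apply: term_model_hom_ext => [n [j x]|n m []].
apply: etrans (evE (AnyCocone c') x) _.
exact: (congr1 (fun g : fc_hom (F j) L' => g n x) (esym (hc j))).
Qed.

End Colimits.

Lemma FC_has_small_colimits (R : comPzRingType) : has_small_colimits (FC R).
Proof.
by move=> J F; exists (colim_fc F), (colim_cocone F); exact: colim_coconeP.
Qed.

(** * Functorial factorizations *)

Section Pullback.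
Variables (R : comPzRingType) (X Y Z : filtered_complex R).
Variables (g : fc_hom X Z) (v : fc_hom Y Z).

Let P : filtered_complex R := prodc (fun b : bool => if b then X else Y).

Definition pb_pred n : {pred P n} := fun z => g n (z true) == v n (z false).

Lemma pb_pred_closed n : submod_closed (@pb_pred n).
Proof.
split=> [|a x y]; rewrite !unfold_in; first by rewrite !linear0.
by move=> /eqP xE /eqP yE; rewrite !prodmodP !linearP xE yE.
Qed.

Lemma pb_pred_d n m (e : m = n + 1) (z : P n) :
  z \in @pb_pred n -> fc_d P e z \in @pb_pred m.
Proof. by rewrite !unfold_in => /eqP E; rewrite !fc_map_d E. Qed.

Definition pb : filtered_complex R := subcomplex pb_pred_closed pb_pred_d
  (fc_F_closed P) (@fc_F_incr R P) (@fc_dF R P).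

Let incl : fc_hom pb P := subc_incl pb_pred_closed pb_pred_d
  (fc_F_closed P) (@fc_F_incr R P) (@fc_dF R P) (fun _ _ _ h => h).

Definition pb_fst : fc_hom pb X := fc_comp (prodc_proj _ true) incl.
Definition pb_snd : fc_hom pb Y := fc_comp (prodc_proj _ false) incl.

Lemma pb_comm n (z : pb n) : g n (pb_fst n z) = v n (pb_snd n z).
Proof. by have /eqP := submod_valP z. Qed.

Lemma pb_ext n (z z' : pb n) :
  pb_fst n z = pb_fst n z' -> pb_snd n z = pb_snd n z' -> z = z'.
Proof.
move=> E1 E2; apply/val_inj.
by apply: functional_extensionality_dep => -[].
Qed.

Lemma pb_F p n (z : pb n) :
  pb_fst n z \in fc_F X p n -> pb_snd n z \in fc_F Y p n -> z \in fc_F pb p n.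
Proof. by move=> F1 F2; apply/asboolP => -[]. Qed.

Section Pair.
Variables (n : int) (x : X n) (y : Y n).

Let pair : P n :=
  fun b => if b as b return (if b then X else Y) n then x else y.

Lemma pb_pair_key (E : g n x = v n y) :
  pair \in submod_pred (@pb_pred_closed n).
Proof. exact/eqP. Qed.

Definition pb_pair (E : g n x = v n y) : pb n := Submod (pb_pair_key E).

Lemma pb_snd_pair (E : g n x = v n y) : pb_snd n (pb_pair E) = y.
Proof. by []. Qed.
End Pair.

Section Universal.
Variables (W : filtered_complex R) (a : fc_hom W X) (b : fc_hom W Y).
Hypothesis E : fc_comp g a = fc_comp v b.

Let E' n x : g n (a n x) = v n (b n x).
Proof. exact: (congr1 (fun h : fc_hom W Z => h n x) E). Qed.

Lemma pb_hom_linear n : linear (fun x : W n => pb_pair (E' x)).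
Proof.
move=> k x y; apply: pb_ext; rewrite (linearP (pb_fst n), linearP (pb_snd n)).
  exact: (linearP (a n)).
exact: (linearP (b n)).
Qed.

Lemma pb_hom_d n m (e : m = n + 1) (x : W n) :
  pb_pair (E' (fc_d W e x)) = fc_d pb e (pb_pair (E' x)).
Proof. by apply: pb_ext; [exact: (fc_map_d a)|exact: (fc_map_d b)]. Qed.

Lemma pb_hom_F p n (x : W n) :
  x \in fc_F W p n -> pb_pair (E' x) \in fc_F pb p n.
Proof.
by move=> xF; apply: pb_F; [exact: (fc_map_F a)|exact: (fc_map_F b)].
Qed.

Definition pb_hom : fc_hom W pb :=
  @FCHom R W pb (fun n => linear_of (@pb_hom_linear n)) pb_hom_d pb_hom_F.

End Universal.

End Pullback.

(** * Lifting problems and the initial factorization *)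

Section Lifting.
Variables (R : comPzRingType) (r : nat) (K : bool).

(* [K] selects the lifting problems against the maps of [I''_r] (if true) or of
   [J''_r] (if false); the latter ignore [x], which is then required to be [0]
   so that both can be handled together. *)
Section Problem.
Variables (X Y : filtered_complex R) (g : fc_hom X Y).
Variables (p n m : int) (e : m = n + 1).

Definition lift_problem (x : X m) (y : Y n) : Prop :=
  [/\ y \in fc_F Y p n,
      K -> [/\ x \in fc_F X (p - r%:Z) m, fc_d X (erefl (m + 1)) x = 0 &
               g m x = fc_d Y e y]
    & ~~ K -> x = 0 /\ fc_d Y e y \in fc_F Y (p - r%:Z) m].

Definition lift_solution (x : X m) (y : Y n) (x' : X n) : Prop :=
  [/\ x' \in fc_F X p n, g n x' = y, K -> fc_d X e x' = x
    & ~~ K -> fc_d X e x' \in fc_F X (p - r%:Z) m].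
End Problem.

Definition lift_operation (X Y : filtered_complex R) :=
  forall p n m : int, m = n + 1 -> X m -> Y n -> X n.

Definition lift_operationP (X Y : filtered_complex R) (g : fc_hom X Y)
    (psi : lift_operation X Y) : Prop :=
  forall p n m (e : m = n + 1) x y,
    lift_problem g p e x y -> lift_solution g p e x y (psi p n m e x y).

Definition has_lifts (X Y : filtered_complex R) (g : fc_hom X Y) : Prop :=
  forall p n m (e : m = n + 1) x y,
    lift_problem g p e x y -> exists x', lift_solution g p e x y x'.

Lemma has_lifts_operation X Y (g : fc_hom X Y) : has_lifts g ->
  exists psi : lift_operation X Y, lift_operationP g psi.
Proof.
move=> gP.
exists (fun p n m e x y =>
  if pselect (exists x', lift_solution g p e x y x') is left h
  then sval (cid h) else 0).
move=> p n m e x y xy; case: pselect => [h|[]]; last exact: gP.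
exact: (svalP (cid h)).
Qed.

Lemma lift_problem_map X X' Y Y' (g : fc_hom X Y) (g' : fc_hom X' Y')
    (h : fc_hom X X') (k : fc_hom Y Y') p n m (e : m = n + 1) x y :
  (forall n x, g' n (h n x) = k n (g n x)) ->
  lift_problem g p e x y -> lift_problem g' p e (h m x) (k n y).
Proof.
move=> E [yF xy1 xy0]; split; first exact: fc_map_F.
  move=> /xy1[xF dx gx]; split; first exact: fc_map_F.
    by rewrite -fc_map_d dx linear0.
  by rewrite E gx fc_map_d.
move=> /xy0[-> dyF]; rewrite linear0 -fc_map_d; split=> //; exact: fc_map_F.
Qed.

Section Factorization.
Variables (A B : filtered_complex R) (f : fc_hom A B).

(* A factorization of [f] with chosen lifts for its second map; the initial one
   replaces the small object argument, and is functorial. *)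
Record factor_alg := FactorAlg {
  fa_ob :> filtered_complex R;
  fa_in : fc_hom A fa_ob;
  fa_out : fc_hom fa_ob B;
  fa_fact : fc_comp fa_out fa_in = f;
  fa_op : lift_operation fa_ob B;
  fa_opP : lift_operationP fa_out fa_op
}.

(** The element of [B], like the weight, belongs to the name of the operation, since all algebras
    lie over the same [B]. Only the prescribed differential is an argument, so the operations are
    unary. *)
Record lift_op (n m : int) : small_type := LiftOp {
  lo_weight : int;
  lo_deg : m = n + 1;
  lo_elt : B n
}.

Definition fact_ob : filtered_complex R :=
  @term_model R factor_alg fa_ob (fun n => A n) lift_op
    (fun c n a => fa_in c n a)
    (fun c n m o x => @fa_op c (lo_weight o) n m (lo_deg o) x (lo_elt o))
    (fun c n m o x =>
      lift_problem (fa_out c) (lo_weight o) (lo_deg o) x (lo_elt o)).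

Definition fact_eval (c : factor_alg) : fc_hom fact_ob c := term_model_eval c.

Definition fact_gen n (a : A n) : fact_ob n := term_model_gen a.

Lemma fact_eval_gen c n (a : A n) : fact_eval c n (fact_gen a) = fa_in c n a.
Proof. exact: term_model_genE. Qed.

Lemma fact_gen_linear n : linear (@fact_gen n).
Proof.
move=> k x y; apply: term_model_ext => c.
by rewrite -/(fact_eval c) linearP !fact_eval_gen linearP.
Qed.

Lemma fact_gen_d n m (e : m = n + 1) (x : A n) :
  fact_gen (fc_d A e x) = fc_d fact_ob e (fact_gen x).
Proof.
apply: term_model_ext => c.
by rewrite -/(fact_eval c) fc_map_d !fact_eval_gen fc_map_d.
Qed.

Lemma fact_gen_F p n (x : A n) :
  x \in fc_F A p n -> fact_gen x \in fc_F fact_ob p n.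
Proof.
move=> xF; apply/term_model_F => c.
by rewrite -/(fact_eval c) fact_eval_gen fc_map_F.
Qed.

Definition fact_in : fc_hom A fact_ob :=
  @FCHom R A fact_ob (fun n => linear_of (@fact_gen_linear n))
    fact_gen_d fact_gen_F.

(** Over the identity of [B] the only possible lift of [y] is [y]. The resulting algebra provides
    the second map of the factorization, as evaluation in it. *)
Lemma target_opP :
  lift_operationP (fc_id B)
    (fun p n m (_ : m = n + 1) (x : B m) (y : B n) => y).
Proof.
by move=> p n m e x y [yF xy1 xy0]; split=> // [/xy1[_ _ <-]|/xy0[]].
Qed.

Definition target_alg : factor_alg := FactorAlg (fc_comp1m f) target_opP.

Definition fact_out : fc_hom fact_ob B := fact_eval target_alg.

Lemma fact_eval_out c : fc_comp (fa_out c) (fact_eval c) = fact_out.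
Proof.
apply: term_model_hom_ext => [n x|n m o q v _].
  apply: etrans (congr1 (fa_out c n) (fact_eval_gen c x)) _.
  apply: etrans _ (esym (fact_eval_gen target_alg x)).
  exact: (congr1 (fun h : fc_hom A B => h n x) (fa_fact c)).
apply: etrans (congr1 (fa_out c n) (term_model_opE c v)) _.
apply: etrans _ (esym (term_model_opE target_alg v)).
by have [] := fa_opP (v c).
Qed.

(** Weights and equations in the term model mean the same in every algebra, and the conditions on
    [y] alone can be read in [target_alg]. Thus the side condition on terms is exactly that of a
    lifting problem over [fact_out], so every such problem has a formal solution. *)
Lemma fact_problem p n m (e : m = n + 1) (q : fact_ob m) (y : B n) :
  lift_problem fact_out p e q y <->
  forall c, lift_problem (fa_out c) p e (fact_eval c m q) y.
Proof.
split=> [qy c|qy].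
  rewrite -[y]/(fc_id B n y).
  apply: lift_problem_map qy => k x.
  exact: (congr1 (fun h : fc_hom fact_ob B => h k x) (fact_eval_out c)).
have [yF q1 q0] := qy target_alg; split=> // [K1|K0].
  have [_ _ qE] := q1 K1; split=> //.
    by apply/term_model_F => c; have [_ /(_ K1)[]] := qy c.
  apply: term_model_ext => c; rewrite -/(fact_eval c) fc_map_d linear0.
  by have [_ /(_ K1)[]] := qy c.
have [_ dyF] := q0 K0; split=> //.
apply: term_model_ext => c; rewrite -/(fact_eval c) linear0.
by have [_ _ /(_ K0)[]] := qy c.
Qed.

Definition fact_op : lift_operation fact_ob B := fun p n m e q y =>
  if pselect (lift_problem fact_out p e q y) is left h
  then @term_model_op _ _ _ _ _ _ _ _ _ _ (LiftOp p e y) q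
    (proj1 (fact_problem _ _ _ _) h)
  else 0.

Lemma fact_eval_op c p n m (e : m = n + 1) (q : fact_ob m) (y : B n) :
  lift_problem fact_out p e q y ->
  fact_eval c n (fact_op p e q y) = @fa_op c p n m e (fact_eval c m q) y.
Proof.
move=> qy; rewrite /fact_op; case: pselect => // h.
exact: term_model_opE.
Qed.

Lemma fact_opP : lift_operationP fact_out fact_op.
Proof.
move=> p n m e q y qy; have /fact_problem qy' := qy.
have s c := fa_opP (qy' c).
split.
- apply/term_model_F => c; rewrite -/(fact_eval c) fact_eval_op //.
  by have [] := s c.
- by rewrite [LHS]fact_eval_op.
- move=> K1; apply: term_model_ext => c.
  rewrite -/(fact_eval c) fc_map_d fact_eval_op //.
  by have [_ _ /(_ K1)] := s c.
move=> K0; apply/term_model_F => c.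
rewrite -/(fact_eval c) fc_map_d fact_eval_op //.
by have [_ _ _ /(_ K0)] := s c.
Qed.

Lemma fact_fact : fc_comp fact_out fact_in = f.
Proof. by apply: fc_hom_ext => n x; exact: (fact_eval_gen target_alg). Qed.

Definition fact_alg : factor_alg := FactorAlg fact_fact fact_opP.

Lemma fact_hom_ext (D : filtered_complex R) (h k : fc_hom fact_ob D) :
  (forall n x, h n (fact_in n x) = k n (fact_in n x)) ->
  (forall p n m (e : m = n + 1) q y, lift_problem fact_out p e q y ->
    h m q = k m q -> h n (fact_op p e q y) = k n (fact_op p e q y)) ->
  h = k.
Proof.
move=> hk hop; apply: term_model_hom_ext => [|n m [p e y] q v hq].
  exact: hk.
have /fact_problem qy : forall c,
    lift_problem (fa_out c) p e (fact_eval c m q) y.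
  by [].
have -> : term_model_op v = fact_op p e q y :> fact_ob n.
  apply: term_model_ext => c; rewrite -/(fact_eval c) fact_eval_op //.
  exact: term_model_opE.
exact: hop.
Qed.

(** Taking [fact_alg] for [c] in [fact_lift_out], this removes the evaluation and leaves a lift
    against [g]. *)
Lemma fact_eval_id : fact_eval fact_alg = fc_id fact_ob.
Proof.
apply: fact_hom_ext => [n x|p n m e q y qy hq]; first exact: fact_eval_gen.
by rewrite fact_eval_op // hq.
Qed.

(* The pullback of [g], with chosen lifts, along a map from an algebra is again
   an algebra, whence a map to it from the initial one. *)
Section Transport.
Variables (c : factor_alg) (X Y : filtered_complex R) (g : fc_hom X Y).
Variables (psi : lift_operation X Y) (psiP : lift_operationP g psi).
Variables (v : fc_hom c Y) (u : fc_hom A X).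
Hypothesis gu : fc_comp g u = fc_comp v (fa_in c).

Let P := pb g v.

Let pin : fc_hom A P := pb_hom gu.
Let pout : fc_hom P B := fc_comp (fa_out c) (pb_snd g v).

Let pfact : fc_comp pout pin = f.
Proof.
rewrite -[RHS](fa_fact c); exact: fc_hom_ext.
Qed.

(** The lift in the pullback is taken first in [c], then by [psi] in [X] above the image of that
    lift, so that the two components agree in [Y]. *)
Let opc p n m (e : m = n + 1) (z : P m) (y : B n) : c n :=
  @fa_op c p n m e (pb_snd g v m z) y.
Let opX p n m (e : m = n + 1) (z : P m) (y : B n) : X n :=
  @psi p n m e (pb_fst g v m z) (v n (opc p e z y)).

Let snd_problem p n m (e : m = n + 1) (z : P m) (y : B n) :
  lift_problem pout p e z y ->
  lift_solution (fa_out c) p e (pb_snd g v m z) y (opc p e z y).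
Proof.
move=> zy; apply: fa_opP; rewrite -[y]/(fc_id B n y).
exact: lift_problem_map zy.
Qed.

Let fst_problem p n m (e : m = n + 1) (z : P m) (y : B n) :
  lift_problem pout p e z y ->
  lift_solution g p e (pb_fst g v m z) (v n (opc p e z y)) (opX p e z y).
Proof.
move=> zy; apply: psiP; have [sF _ s1 s0] := snd_problem zy.
case: zy => _ z1 z0; split=> [|K1|K0]; first exact: fc_map_F.
  have [zF dz _] := z1 K1; split; first exact: fc_map_F.
    by rewrite -fc_map_d dz linear0.
  by rewrite pb_comm -fc_map_d s1.
have [zE _] := z0 K0; rewrite -fc_map_d; split; first by rewrite zE linear0.
by apply: fc_map_F; exact: s0.
Qed.

Let pop : lift_operation P B := fun p n m e z y =>
  if pselect (g n (opX p e z y) = v n (opc p e z y)) is left h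
  then pb_pair h else 0.

Let pop_fst p n m (e : m = n + 1) (z : P m) (y : B n) :
  lift_problem pout p e z y -> pb_fst g v n (pop p e z y) = opX p e z y.
Proof.
by move=> /fst_problem[_ s _ _]; rewrite /pop; case: pselect.
Qed.

Let pop_snd p n m (e : m = n + 1) (z : P m) (y : B n) :
  lift_problem pout p e z y -> pb_snd g v n (pop p e z y) = opc p e z y.
Proof.
by move=> /fst_problem[_ s _ _]; rewrite /pop; case: pselect.
Qed.

Let popP : lift_operationP pout pop.
Proof.
move=> p n m e z y zy.
have [F1 E1 d1 d1'] := fst_problem zy.
have [F2 E2 d2 d2'] := snd_problem zy.
split.
- by apply: pb_F; rewrite ?pop_fst ?pop_snd.
- exact: etrans (congr1 (fa_out c n) (pop_snd zy)) E2.
- by move=> K1; apply: pb_ext; rewrite fc_map_d ?pop_fst ?pop_snd ?d1 ?d2.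
by move=> K0; apply: pb_F; rewrite fc_map_d ?pop_fst ?pop_snd ?d1' ?d2'.
Qed.

Let palg : factor_alg := FactorAlg pfact popP.

(** It serves twice: with [c] the initial algebra it solves lifting problems for [fact_in], and with
    [c] the target algebra it makes the factorization functorial. In the latter case [fact_lift_op]
    shows that chosen lifts are preserved, whence identities and composites are. *)
Definition fact_lift : fc_hom fact_ob X :=
  fc_comp (pb_fst g v) (fact_eval palg).

Let snd_lift : fc_comp (pb_snd g v) (fact_eval palg) = fact_eval c.
Proof.
apply: fact_hom_ext => [n x|p n m e q y qy hq].
  apply: etrans (congr1 (pb_snd g v n) (fact_eval_gen palg x)) _.
  exact: (esym (fact_eval_gen c x)).
apply: etrans (congr1 (pb_snd g v n) (fact_eval_op palg qy)) _.
have /fact_problem/(_ palg) zy := qy.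
rewrite (fact_eval_op c qy) -hq; exact: (pop_snd zy).
Qed.

Lemma fact_lift_in : fc_comp fact_lift fact_in = u.
Proof.
apply: fc_hom_ext => n x.
exact: (congr1 (pb_fst g v n) (fact_eval_gen palg x)).
Qed.

Lemma fact_lift_out : fc_comp g fact_lift = fc_comp v (fact_eval c).
Proof.
by rewrite -snd_lift; apply: fc_hom_ext => n x; exact: pb_comm.
Qed.

Lemma fact_lift_op p n m (e : m = n + 1) (q : fact_ob m) (y : B n) :
  lift_problem fact_out p e q y ->
  fact_lift n (fact_op p e q y) =
    @psi p n m e (fact_lift m q) (v n (@fa_op c p n m e (fact_eval c m q) y)).
Proof.
move=> qy; apply: etrans (congr1 (pb_fst g v n) (fact_eval_op palg qy)) _.
have /fact_problem/(_ palg) zy := qy.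
by rewrite -snd_lift; exact: (pop_fst zy).
Qed.

End Transport.

Lemma fact_out_has_lifts : has_lifts fact_out.
Proof. by move=> p n m e x y xy; eexists; exact: fact_opP xy. Qed.

Lemma fact_in_lifts (X Y : FC R) (g : mor X Y) :
  has_lifts g -> lifts (fact_in : mor (A : FC R) fact_ob) g.
Proof.
move=> /has_lifts_operation[psi psiP] u v E.
exists (fact_lift (c := fact_alg) psiP (esym E)); split.
  exact: fact_lift_in.
by rewrite [LHS]fact_lift_out fact_eval_id; exact: fc_compm1.
Qed.

End Factorization.

Section Functoriality.
Variables (A B A' B' : filtered_complex R) (f : fc_hom A B) (f' : fc_hom A' B').
Variables (u : fc_hom A A') (v : fc_hom B B').
Hypothesis E : fc_comp v f = fc_comp f' u.

Lemma fact_map_subproof : fc_comp (fact_out f') (fc_comp (fact_in f') u)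
  = fc_comp v (fa_in (target_alg f)).
Proof. by rewrite fc_compA fact_fact -E. Qed.

Definition fact_map : fc_hom (fact_ob f) (fact_ob f') :=
  fact_lift (c := target_alg f) (@fact_opP _ _ f') fact_map_subproof.

Lemma fact_map_in : fc_comp fact_map (fact_in f) = fc_comp (fact_in f') u.
Proof. exact: fact_lift_in. Qed.

Lemma fact_map_inE n (x : A n) :
  fact_map n (fact_in f n x) = fact_in f' n (u n x).
Proof. exact: (congr1 (fun h : fc_hom _ _ => h n x) fact_map_in). Qed.

Lemma fact_map_out : fc_comp (fact_out f') fact_map = fc_comp v (fact_out f).
Proof. exact: fact_lift_out. Qed.

Lemma fact_map_op p n m (e : m = n + 1) (q : fact_ob f m) (y : B n) :
  lift_problem (fact_out f) p e q y ->
  fact_map n (fact_op p e q y) = fact_op p e (fact_map m q) (v n y).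
Proof. exact: fact_lift_op. Qed.

Lemma fact_map_problem p n m (e : m = n + 1) (q : fact_ob f m) (y : B n) :
  lift_problem (fact_out f) p e q y ->
  lift_problem (fact_out f') p e (fact_map m q) (v n y).
Proof.
apply: lift_problem_map => k x.
exact: (congr1 (fun h : fc_hom _ _ => h k x) fact_map_out).
Qed.

End Functoriality.

Lemma fact_map_id (A B : filtered_complex R) (f : fc_hom A B)
    (E : fc_comp (fc_id B) f = fc_comp f (fc_id A)) :
  fact_map E = fc_id (fact_ob f).
Proof.
apply: fact_hom_ext => [n x|p n m e q y qy hq].
  exact: fact_map_inE.
by rewrite fact_map_op // hq.
Qed.

Lemma fact_map_comp (A B A' B' A'' B'' : filtered_complex R)
    (f : fc_hom A B) (f' : fc_hom A' B') (f'' : fc_hom A'' B'')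
    (u : fc_hom A A') (v : fc_hom B B')
    (u' : fc_hom A' A'') (v' : fc_hom B' B'')
    (e : fc_comp v f = fc_comp f' u) (e' : fc_comp v' f' = fc_comp f'' u')
    (e'' : fc_comp (fc_comp v' v) f = fc_comp f'' (fc_comp u' u)) :
  fact_map e'' = fc_comp (fact_map e') (fact_map e).
Proof.
apply: fact_hom_ext => [n x|p n m d q y qy hq].
  apply: etrans (fact_map_inE e'' x) _; apply: esym.
  exact: etrans (congr1 (fact_map e' n) (fact_map_inE e x)) (fact_map_inE e' _).
rewrite fact_map_op // hq; apply: esym.
apply: etrans (congr1 (fact_map e' n) (fact_map_op e qy)) _.
exact: (fact_map_op e' (fact_map_problem e qy)).
Qed.

Definition lift_factorization (P Q : mor_class (FC R))
    (Pin : forall (A B : FC R) (f : mor A B),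
      (forall (X Y : FC R) (g : mor X Y), has_lifts g ->
        lifts (fact_in f : mor A (fact_ob f : FC R)) g) ->
      P A (fact_ob f) (fact_in f))
    (Qout : forall (A B : FC R) (f : mor A B), has_lifts f -> Q A B f) :
    functorial_factorization P Q :=
  @FunctorialFactorization (FC R) P Q
    (fun a b f => fact_ob f) (fun a b f => fact_in f) (fun a b f => fact_out f)
    (fun a b f => fact_fact f)
    (fun a b f => Pin a b f (@fact_in_lifts a b f))
    (fun a b f => Qout _ _ _ (@fact_out_has_lifts a b f))
    (fun a b a' b' f f' u v e => fact_map e)
    (fun a b a' b' f f' u v e => fact_map_in e)
    (fun a b a' b' f f' u v e => fact_map_out e)
    (fun a b f e => fact_map_id e)
    (fun a b a' b' a'' b'' f f' f'' u v u' v' e e' e'' =>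
      fact_map_comp e e' e'').

End Lifting.

(** * Weak equivalences and fibrations on elements *)

Section QuasiIso.
Variables (R : comPzRingType) (r : nat).
Implicit Types A B C D : filtered_complex R.

Lemma fc_d_eq0 A n m m' (e : m = n + 1) (e' : m' = n + 1) (x : A n) :
  fc_d A e x = 0 -> fc_d A e' x = 0.
Proof. by subst m m'. Qed.

Definition Zr_H A B (f : fc_hom A B) i j :
    bg_cohomology (Zr r A) i j -> bg_cohomology (Zr r B) i j :=
  @bg_cohomology_map R r _ _ (Zr_map r f) i j.

Lemma Zr_H_id A i j : Zr_H (fc_id A) (i := i) (j := j) =1 id.
Proof.
move=> c; rewrite -[c]homology_reprK -/(bg_class _) /Zr_H bg_cohomology_mapE.
by apply: (congr1 (@bg_class R r _ i j)); apply/val_inj/val_inj.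
Qed.

Lemma Zr_H_comp A B C (g : fc_hom B C) (f : fc_hom A B) i j c :
  Zr_H (fc_comp g f) (i := i) (j := j) c = Zr_H g (Zr_H f c).
Proof.
rewrite -[c]homology_reprK -/(bg_class _) /Zr_H !bg_cohomology_mapE.
by apply: (congr1 (@bg_class R r _ i j)); apply/val_inj/val_inj.
Qed.

Lemma Zr_quasi_iso_id A : Zr_quasi_iso r (fc_id A : mor (A : FC R) A).
Proof.
by move=> i j; exists id => c; rewrite [bg_cohomology_map _ _]Zr_H_id.
Qed.

Lemma Zr_quasi_iso_comp (A B C : FC R) (g : mor B C) (f : mor A B) :
  Zr_quasi_iso r f -> Zr_quasi_iso r g -> Zr_quasi_iso r (g ∘ f).
Proof.
move=> fq gq i j.
apply: (@eq_bij _ _ (Zr_H g (i := i) (j := j) \o Zr_H f (i := i) (j := j))).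
  exact: bij_comp (gq i j) (fq i j).
by move=> c; exact: esym (Zr_H_comp g f c).
Qed.

Lemma Zr_quasi_iso_two_of_three : two_of_three (@Zr_quasi_iso R r).
Proof.
move=> A B C g f; split=> [|fq gfq i j|gq gfq i j].
- exact: Zr_quasi_iso_comp.
- have [f' fK f'K] := fq i j.
  apply: (@eq_bij _ _ (Zr_H (g ∘ f) (i := i) (j := j) \o f')).
    by apply: bij_comp (gfq i j) _; exists (Zr_H f (i := i) (j := j)).
  by move=> c; rewrite /= Zr_H_comp /= [Zr_H f _]f'K.
have [g' gK g'K] := gq i j.
apply: (@eq_bij _ _ (g' \o Zr_H (g ∘ f) (i := i) (j := j))).
  by apply: bij_comp _ (gfq i j); exists (Zr_H g (i := i) (j := j)).
by move=> c; rewrite /= Zr_H_comp /= [g' _]gK.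
Qed.

Lemma Zr_quasi_iso_retract : retract_closed (@Zr_quasi_iso R r).
Proof.
move=> A B C D f g [s [p [s' [p' [ps ps' gs fp]]]]] gq i j.
have [g' gK g'K] := gq i j.
pose H := fun A B (h : mor (A : FC R) B) => Zr_H h (i := i) (j := j).
have HC (X Y Z : FC R) (k : mor Y Z) (h : mor X Y) c :
    H _ _ k (H _ _ h c) = H _ _ (k ∘ h) c.
  by rewrite /H Zr_H_comp.
exists (fun c => H _ _ p (g' (H _ _ s' c))) => c.
  rewrite -[bg_cohomology_map _ _]/(H _ _ f c) HC -gs -HC.
  by rewrite [g' _]gK HC ps; exact: Zr_H_id.
rewrite -[bg_cohomology_map _ _]/(H _ _ f _) HC fp -HC.
by rewrite [H _ _ g _]g'K HC ps'; exact: Zr_H_id.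
Qed.

Section Elements.
Variables (A : filtered_complex R) (i j : int).

Lemma Zr_elementP (m : int) (e : m = j - i + 1) (a : A (j - i)) :
  a \in fc_F A i (j - i) -> fc_d A e a \in fc_F A (i - r%:Z) m ->
  exists x : Zr r A i j, submod_val x = a.
Proof.
move=> aF daF.
have h : a \in submod_pred (@Zr_pred_closed R r A i j).
  by rewrite /submod_pred (Zr_predE r e); apply/andP.
by exists (Submod h).
Qed.

Lemma Zr_cocycleP (m : int) (e : m = j - i + 1) (a : A (j - i)) :
  a \in fc_F A i (j - i) -> fc_d A e a = 0 ->
  exists x : bg_cocycles (Zr r A) i j, submod_val (submod_val x) = a.
Proof.
move=> aF da; have [|x xa] := Zr_elementP (e := e) aF.
  by rewrite da fc_F0.
have h : x \in submod_pred
    (ker_pred_closed (@bg_d R r (Zr r A) i j _ _ erefl erefl)).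
  by apply/eqP/val_inj; rewrite /= xa; exact: fc_d_eq0 da.
by exists (Submod h).
Qed.

Lemma Zr_cocycle_F (x : bg_cocycles (Zr r A) i j) :
  submod_val (submod_val x) \in fc_F A i (j - i).
Proof.
have := submod_valP (submod_val x).
by rewrite /submod_pred (Zr_predE r erefl) => /andP[].
Qed.

Lemma Zr_cocycle_d (m : int) (e : m = j - i + 1)
    (x : bg_cocycles (Zr r A) i j) :
  fc_d A e (submod_val (submod_val x)) = 0.
Proof.
have /eqP/(congr1 (@submod_val _ _ _ _)) := submod_valP x.
exact: fc_d_eq0.
Qed.

(** An element [w] of weight [i + r] lies in [Z_r] as soon as [d w] has weight [(i + r) - r = i],
    and this is automatic when [d w] is [a]. Boundaries may thus be sought in the whole of
    [F_(i+r)]. *)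
Lemma Zr_boundaryP (m : int) (e : j - i = m + 1) (a : Zr r A i j) :
  (exists u : Zr r A (i + r%:Z) (j - 1 + r%:Z),
     bg_d (Zr r A) (bg_in_i r i) (bg_in_j r j) u = a) <->
  (exists2 w : A m, w \in fc_F A (i + r%:Z) m & fc_d A e w = submod_val a).
Proof.
have mE : m = (j - 1 + r%:Z) - (i + r%:Z) by lia.
subst m; split=> [[u <-]|[w wF dw]].
  exists (submod_val u).
    have := submod_valP u.
    by rewrite /submod_pred (Zr_predE r erefl) => /andP[].
  by rewrite (Prop_irrelevance e (Zr_degree (bg_in_i r i) (bg_in_j r j))).
have h : w \in submod_pred (@Zr_pred_closed R r A (i + r%:Z) (j - 1 + r%:Z)).
  rewrite /submod_pred (Zr_predE r e) wF dw addrK.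
  have := submod_valP a.
  by rewrite /submod_pred (Zr_predE r erefl) => /andP[].
exists (Submod h); apply/val_inj; rewrite /= -dw.
by rewrite (Prop_irrelevance e (Zr_degree (bg_in_i r i) (bg_in_j r j))).
Qed.

Lemma Zr_class_eq (m : int) (e : j - i = m + 1)
    (x y : bg_cocycles (Zr r A) i j) :
  bg_class x = bg_class y <->
  exists2 w : A m, w \in fc_F A (i + r%:Z) m &
    fc_d A e w = submod_val (submod_val x) - submod_val (submod_val y).
Proof.
have E (u v : Zr r A i j) : submod_val (u - v) = submod_val u - submod_val v.
  exact: (linearB (@submod_val R _ _ (@Zr_pred_closed R r A i j))).
by rewrite bg_classE (Zr_boundaryP e) E.
Qed.

End Elements.

Definition homology_surj A B (f : fc_hom A B) : Prop :=
  forall (p n m : int) (e : n = m + 1) (y : B n),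
    y \in fc_F B p n -> fc_d B (erefl (n + 1)) y = 0 ->
    exists (x : A n) (z : B m), [/\ x \in fc_F A p n,
      fc_d A (erefl (n + 1)) x = 0, z \in fc_F B (p + r%:Z) m
      & fc_d B e z = f n x - y].

Definition homology_inj A B (f : fc_hom A B) : Prop :=
  forall (p n m : int) (e : n = m + 1) (x : A n) (z : B m),
    x \in fc_F A p n -> fc_d A (erefl (n + 1)) x = 0 ->
    z \in fc_F B (p + r%:Z) m -> fc_d B e z = f n x ->
    exists2 w : A m, w \in fc_F A (p + r%:Z) m & fc_d A e w = x.

Lemma Zr_quasi_isoP (A B : FC R) (f : mor A B) :
  Zr_quasi_iso r f <-> homology_surj f /\ homology_inj f.
Proof.
split=> [fq|[fs fi] i j].
  (* In bidegree [(p, j)] the degree is [j - p], so every pair of a weight and a degree is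
     reached. *)
  split=> p n m; have [j ->] : exists j, n = j - p by exists (n + p); lia.
    move=> e y yF dy; have [y' y'E] := Zr_cocycleP yF dy.
    have [g fK gK] := fq p j.
    have := gK (bg_class y').
    rewrite -[g _]homology_reprK -/(bg_class _) bg_cohomology_mapE.
    set x := homology_repr _ => /(Zr_class_eq e)[z zF dz].
    exists (submod_val (submod_val x)), z; split=> //.
    - exact: Zr_cocycle_F.
    - exact: Zr_cocycle_d.
    - by rewrite dz y'E.
  move=> e x z xF dx zF dz; have [x' x'E] := Zr_cocycleP xF dx.
  have /(bij_inj (fq p j)) : bg_cohomology_map (Zr_map r f) (bg_class x') =
      bg_cohomology_map (Zr_map r f) (bg_class 0).
    rewrite !bg_cohomology_mapE; apply/(Zr_class_eq e).
    exists z => //.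
    by rewrite dz /= x'E linear0 subr0.
  move=> /(Zr_class_eq e)[w wF dw]; exists w => //.
  by rewrite dw x'E /= subr0.
have e : j - i = (j - i - 1) + 1 by rewrite subrK.
have inj : injective (Zr_H f (i := i) (j := j)).
  move=> c c'; rewrite -[c]homology_reprK -[c']homology_reprK -!/(bg_class _).
  set x := homology_repr c; set x' := homology_repr c'.
  rewrite /Zr_H !bg_cohomology_mapE => /(Zr_class_eq e)[z zF dz].
  apply/(Zr_class_eq e).
  apply: (fi i _ _ e _ z) => //.
  - by rewrite fc_FB // Zr_cocycle_F.
  - by rewrite linearB !Zr_cocycle_d subrr.
  - by rewrite dz linearB.
have surj (c : bg_cohomology (Zr r B) i j) : exists c', Zr_H f c' = c.
  rewrite -[c]homology_reprK -!/(bg_class _); set y := homology_repr c.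
  have [x [z [xF dx zF dz]]] :=
    fs i _ _ e _ (Zr_cocycle_F y) (Zr_cocycle_d _ y).
  have [x' x'E] := Zr_cocycleP xF dx.
  exists (bg_class x'); rewrite /Zr_H bg_cohomology_mapE.
  apply/(Zr_class_eq e); exists z => //.
  by rewrite dz /= x'E.
have [g gK] := choice surj.
by exists g => // c; apply: inj; exact: gK.
Qed.

Lemma Zr_surjectiveP (A B : FC R) (f : mor A B) :
  Zr_surjective r f <-> has_lifts r false f.
Proof.
split=> [fs p n m|fs i j y].
  have [j ->] : exists j, n = j - p by exists (n + p); lia.
  move=> e x y [yF _ /(_ isT)[-> dyF]]; have [y' y'E] := Zr_elementP yF dyF.
  have [x' /(congr1 (@submod_val _ _ _ _)) x'E] := fs _ _ y'.
  have := submod_valP x'; rewrite /submod_pred (Zr_predE r e) => /andP[xF dxF].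
  by exists (submod_val x'); split=> //; rewrite -y'E -x'E.
have := submod_valP y; rewrite /submod_pred (Zr_predE r erefl) => /andP[yF dyF].
have [|x [xF xE _ /(_ isT) dxF]] := fs i _ _ erefl 0 (submod_val y).
  by split.
have [x' x'E] := Zr_elementP xF dxF.
by exists x'; apply/val_inj; rewrite /= x'E.
Qed.

Lemma trivial_fibrationP (A B : FC R) (f : mor A B) :
  has_lifts r true f <-> Zr_surjective r f /\ Zr_quasi_iso r f.
Proof.
rewrite Zr_surjectiveP Zr_quasi_isoP; split=> [fl|[fs [hs hi]]].
  split; [|split].
  - move=> p n m e x y [yF _ /(_ isT)[-> dyF]].
    (* Two lifts: first [d y], of weight [p - r], to a cocycle [a], then [y] to an element with
       differential [a]. *)
    have [|a [aF fa /(_ isT) da _]] :=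
      fl (p - r%:Z) m (m + 1) erefl 0 (fc_d B e y).
      by split=> // _; split; rewrite ?fc_F0 ?linear0 // fc_dd.
    have [|x' [xF fx /(_ isT) dx _]] := fl p n m e a y.
      by split=> // _; split=> //; exact: fc_d_eq0 da.
    by exists x'; split=> // _; rewrite dx.
  - move=> p n m e y yF dy.
    have [|x [xF fx /(_ isT) dx _]] := fl p n (n + 1) erefl 0 y.
      by split=> // _; split; rewrite ?fc_F0 ?linear0.
    by exists x, 0; split; rewrite ?fc_F0 ?linear0 // fx subrr.
  move=> p n m e x z xF dx zF dz.
  (* A cocycle [x] that becomes a boundary [d z] is a lifting problem of weight [p + r], whose
     solution bounds [x]. *)
  have [|w [wF _ /(_ isT) dw _]] := fl (p + r%:Z) m n e x z.
    by split=> // _; split; rewrite ?addrK //; exact: fc_d_eq0 dx.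
  by exists w.
move=> p n m e x y [yF /(_ isT)[xF dx fx] _].
(* Since [f x] bounds, [x = d w], so [w] has the right differential, and [y - f w] is a cocycle. It
   equals [f a - d z] for a cocycle [a] of [A]. Lifting [z] to [z'] along the fibration,
   [w + a - d z'] lies over [y] and still has differential [x]. *)
have [|w wF dw] := hi (p - r%:Z) m n e x y xF (fc_d_eq0 _ dx) _ (esym fx).
  by rewrite subrK.
rewrite subrK in wF.
have e' : n = (n - 1) + 1 by rewrite subrK.
have [||a [z [aF da zF dz]]] := hs p n (n - 1) e' (y - f n w).
- by rewrite fc_FB // fc_map_F.
- apply: (@fc_d_eq0 _ _ _ _ e); rewrite linearB -fc_map_d dw fx subrr //.
have [|z' [z'F fz _ /(_ isT) dz']] := fs (p + r%:Z) _ _ e' 0 z.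
  split=> // _; split=> //.
  by rewrite addrK dz fc_FB ?fc_map_F // fc_FB ?fc_map_F.
rewrite addrK in dz'.
exists (w + a - fc_d A e' z'); split=> // [||_].
- by rewrite fc_FB // fc_FD.
- by rewrite linearB linearD fc_map_d fz dz -addrA subKr addrC subrK.
by rewrite linearB linearD fc_dd subr0 dw (fc_d_eq0 _ da) addr0.
Qed.

End QuasiIso.

(** * The model structure *)

Section CategoryLemmas.
Variable C : category.

Lemma mcomp1m (a b : C) (f : mor a b) : idm b ∘ f = f.
Proof. exact: comp1m_on. Qed.

Lemma mcompm1 (a b : C) (f : mor a b) : f ∘ idm a = f.
Proof. exact: compm1_on. Qed.

Lemma mcompA (a b c d : C) (h : mor c d) (g : mor b c) (f : mor a b) :
  h ∘ (g ∘ f) = (h ∘ g) ∘ f.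
Proof. exact: compA_on. Qed.

Lemma lifts_id (a c d : C) (g : mor c d) : lifts (idm a) g.
Proof.
by move=> u v E; exists u; split; [exact: mcompm1|rewrite -E mcompm1].
Qed.

Lemma lifts_comp (a b c x y : C) (f' : mor b c) (f : mor a b) (g : mor x y) :
  lifts f g -> lifts f' g -> lifts (f' ∘ f) g.
Proof.
move=> fg f'g u v E.
have [|h [hf gh]] := fg u (v ∘ f'); first by rewrite -mcompA.
have [|h' [h'f' gh']] := f'g h v; first by rewrite gh.
by exists h'; split=> //; rewrite mcompA h'f'.
Qed.

Lemma lifts_retract (a b c d x y : C) (f : mor a b) (f' : mor c d)
    (g : mor x y) :
  retract_of f f' -> lifts f' g -> lifts f g.
Proof.
move=> [i [p [i' [p' [pi p'i' f'i fp]]]]] f'g u v E.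
have [|h [hf gh]] := f'g (u ∘ p) (v ∘ p').
  by rewrite -mcompA -fp !mcompA E.
exists (h ∘ i'); split.
  by rewrite -mcompA -f'i mcompA hf -mcompA pi mcompm1.
by rewrite mcompA gh -mcompA p'i' mcompm1.
Qed.

(* If [f = q ∘ i] lifts against [q] then [f] is a retract of [i]. *)
Lemma lifts_factor (a b e x y : C) (f : mor a b) (i : mor a e) (q : mor e b)
    (g : mor x y) :
  q ∘ i = f -> lifts f q -> lifts i g -> lifts f g.
Proof.
move=> qi fq; apply: lifts_retract.
have [|h [hf qh]] := fq i (idm b); first by rewrite mcomp1m qi.
by exists (idm a), (idm a), h, q; rewrite !mcompm1.
Qed.

End CategoryLemmas.

Section Zero.
Variable R : comPzRingType.

Lemma to_zero_linear (V : lmodType R) : linear (fun _ : V => 0 : 'rV[R]_0).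
Proof. by move=> a x y; rewrite scaler0 addr0. Qed.

Definition to_zero (A : filtered_complex R) : fc_hom A (zero_complex R) :=
  @FCHom R A (zero_complex R) (fun n => linear_of (@to_zero_linear (A n)))
    (fun _ _ _ _ => erefl) (fun _ _ _ _ => isT).

Lemma to_zero_unique (A : filtered_complex R)
    (f g : fc_hom A (zero_complex R)) : f = g.
Proof. by apply: fc_hom_ext => n x; rewrite [LHS]thinmx0 [RHS]thinmx0. Qed.

Lemma from_zero_unique (A : filtered_complex R)
    (f g : fc_hom (zero_complex R) A) : f = g.
Proof. by apply: fc_hom_ext => n x; rewrite [x]thinmx0 !linear0. Qed.

Lemma to_zero_has_lifts r (A : filtered_complex R) :
  has_lifts r false (to_zero A).
Proof.
move=> p n m e x y [_ _ /(_ isT)[-> _]]; exists 0.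
split=> //; first exact: fc_F0.
  by rewrite [RHS]thinmx0.
by rewrite linear0 fc_F0.
Qed.

End Zero.

(** * Path objects and homotopies of weight [r] *)

Section Path.
Variables (R : comPzRingType) (r : nat).

Section Cast.
Variable A : filtered_complex R.

(** For [m = n + 1], the differential of the path object sends its components of degree [n] to the
    slot of degree [m - 1], which is equal to [n] only up to a proof. *)
Definition fc_cast_fun n m (e : n = m) (x : A n) : A m := ecast k (A k) e x.

Lemma fc_cast_linear n m (e : n = m) : linear (fc_cast_fun e).
Proof. by subst m. Qed.

Definition fc_cast n m (e : n = m) : {linear A n -> A m} :=
  linear_of (fc_cast_linear e).

Lemma fc_cast_d n m n' m' (en : n = n') (em : m = m') (e : m = n + 1)
    (e' : m' = n' + 1) (x : A n) :
  fc_cast em (fc_d A e x) = fc_d A e' (fc_cast en x).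
Proof. by subst n' m'; rewrite (Prop_irrelevance e e'). Qed.

Lemma fc_cast_F p n m (e : n = m) (x : A n) :
  x \in fc_F A p n -> fc_cast e x \in fc_F A p m.
Proof. by subst m. Qed.

Lemma fc_cast_inj n m (e : n = m) : injective (fc_cast e).
Proof. by subst m. Qed.

End Cast.

Section PathObject.
Variable A : filtered_complex R.

Definition path_mod (n : int) : lmodType R := (A n * A n * A (n - 1))%type.

Lemma path_deg (n m : int) : m = n + 1 -> n = m - 1.
Proof. by move=> ->; rewrite addrK. Qed.

Lemma path_deg1 (n m : int) : m = n + 1 -> m - 1 = (n - 1) + 1.
Proof. lia. Qed.

(** The usual cocylinder, sending [(a, b, h)] to [(d a, d b, a - b - d h)]: a map into it is a pair
    of maps with a homotopy between them. *)
Definition path_d_fun n m (e : m = n + 1) (x : path_mod n) : path_mod m :=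
  (fc_d A e x.1.1, fc_d A e x.1.2,
   fc_cast A (path_deg e) (x.1.1 - x.1.2) - fc_d A (path_deg1 e) x.2).

Lemma path_d_linear n m (e : m = n + 1) : linear (path_d_fun e).
Proof.
move=> a x y; apply: (congr2 pair (congr2 pair _ _) _); try exact: linearP.
rewrite /= opprD addrACA -scalerBr !linearP /= fc_cast_linear.
by rewrite addrACA -scalerDr.
Qed.

Lemma path_dd n m l (e : m = n + 1) (e' : l = m + 1) (x : path_mod n) :
  path_d_fun e' (path_d_fun e x) = 0.
Proof.
apply: (congr2 pair (congr2 pair _ _) _); try exact: fc_dd.
rewrite -[LHS]/(fc_cast A (path_deg e') (fc_d A e x.1.1 - fc_d A e x.1.2) -
  fc_d A (path_deg1 e')
    (fc_cast A (path_deg e) (x.1.1 - x.1.2) - fc_d A (path_deg1 e) x.2)).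
rewrite -(linearB (fc_d A e)) (fc_cast_d (path_deg e) _ _ (path_deg1 e')).
by rewrite (linearB (fc_d A (path_deg1 e'))) fc_dd subr0 subrr.
Qed.

(** Weight [p + r] on the homotopy makes the endpoint map a fibration: lifting [(a, b)] by
    [(a, b, 0)], the differential has third component [a - b], of weight [p = (p - r) + r], as
    membership in weight [p - r] requires. Stability under the differential uses that [r] is
    nonnegative. *)
Definition path_F (p n : int) : {pred path_mod n} := fun x =>
  [&& x.1.1 \in fc_F A p n, x.1.2 \in fc_F A p n &
      x.2 \in fc_F A (p + r%:Z) (n - 1)].

Lemma path_F_closed p n : submod_closed (@path_F p n).
Proof.
split=> [|a x y]; first by apply/and3P; split; exact: fc_F0.
move=> /and3P[x1 x2 x3] /and3P[y1 y2 y3].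
by apply/and3P; split; exact: fc_FP.
Qed.

Lemma path_F_incr p n (x : path_mod n) :
  x \in @path_F (p - 1) n -> x \in @path_F p n.
Proof.
move=> /and3P[x1 x2 x3]; apply/and3P; split; try exact: fc_F_incr.
by apply: fc_F_incr; rewrite addrAC.
Qed.

Lemma path_dF p n m (e : m = n + 1) (x : path_mod n) :
  x \in @path_F p n -> path_d_fun e x \in @path_F p m.
Proof.
move=> /and3P[x1 x2 x3]; apply/and3P; split; try exact: fc_dF.
apply: fc_FB; last exact: fc_dF.
by apply: fc_cast_F; apply: fc_F_incr_nat; exact: fc_FB.
Qed.

Definition path : filtered_complex R :=
  @FilteredComplex R path_mod (fun n m e => linear_of (path_d_linear e)) path_dd
    path_F path_F_closed path_F_incr path_dF.

Let square : filtered_complex R := prodc (fun _ : bool => A).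

Definition path_ends_fun n (x : path n) : square n :=
  fun b => if b then x.1.1 else x.1.2.

Lemma path_ends_linear n : linear (@path_ends_fun n).
Proof. by move=> a x y; apply: functional_extensionality_dep => -[]. Qed.

Lemma path_ends_d n m (e : m = n + 1) (x : path n) :
  path_ends_fun (fc_d path e x) = fc_d square e (path_ends_fun x).
Proof. by apply: functional_extensionality_dep => -[]. Qed.

Lemma path_ends_F p n (x : path n) :
  x \in fc_F path p n -> path_ends_fun x \in fc_F square p n.
Proof. by move=> /and3P[x1 x2 _]; apply/asboolP => -[]. Qed.

Definition path_ends : fc_hom path square :=
  @FCHom R path square (fun n => linear_of (@path_ends_linear n))
    path_ends_d path_ends_F.

Lemma path_ends_has_lifts : has_lifts r false path_ends.
Proof.
move=> p n m e x y [/asboolP yF _ /(_ isT)[_ /asboolP dyF]].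
exists ((y true, y false), 0); split=> // [||_].
- by apply/and3P; split; [exact: yF|exact: yF|exact: fc_F0].
- by apply: functional_extensionality_dep => -[].
apply/and3P; split; [exact: dyF|exact: dyF|].
rewrite /= linear0 subr0 subrK; apply: fc_cast_F; apply: fc_FB; exact: yF.
Qed.

Lemma path_const_linear (B : filtered_complex R) (f : fc_hom B A) n :
  linear (fun x : B n => ((f n x, f n x), 0) : path n).
Proof.
move=> a x y; apply: (congr2 pair (congr2 pair _ _) _); try exact: linearP.
exact: esym (etrans (addr0 _) (scaler0 _ _)).
Qed.

Lemma path_const_d (B : filtered_complex R) (f : fc_hom B A) n m
    (e : m = n + 1) (x : B n) :
  ((f m (fc_d B e x), f m (fc_d B e x)), 0) = fc_d path e ((f n x, f n x), 0).
Proof.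
apply: (congr2 pair (congr2 pair _ _) _); try exact: fc_map_d.
rewrite -[RHS]/(fc_cast A (path_deg e) (f n x - f n x) -
  fc_d A (path_deg1 e) 0).
by rewrite subrr !linear0 addr0.
Qed.

Lemma path_const_F (B : filtered_complex R) (f : fc_hom B A) p n (x : B n) :
  x \in fc_F B p n -> (((f n x, f n x), 0) : path n) \in fc_F path p n.
Proof.
by move=> xF; apply/and3P; split; rewrite ?fc_F0 //; exact: fc_map_F.
Qed.

Definition path_const (B : filtered_complex R) (f : fc_hom B A) :
    fc_hom B path :=
  @FCHom R B path (fun n => linear_of (@path_const_linear B f n))
    (@path_const_d B f) (@path_const_F B f).

End PathObject.

(** Lifting against [A -> 0] gives a retraction [s] of [i]; lifting against the endpoints of
    [path Q] gives a homotopy [h] from [i ∘ s] to the identity. On a cocycle [y], the third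
    component of [h y] bounds [i (s y) - y], which gives surjectivity. If [i x = d z], then
    [d (s z) = s (i x) = x], which gives injectivity. *)
Lemma lifts_fibrations_weq (A Q : FC R) (i : mor A Q) :
  (forall (X Y : FC R) (g : mor X Y), has_lifts r false g -> lifts i g) ->
  Zr_quasi_iso r i.
Proof.
move=> il.
have [|s [si _]] := il _ _ (to_zero A : mor A _) (@to_zero_has_lifts R r A)
  (idm A) (to_zero Q).
  exact: to_zero_unique.
have siE n x : (s : fc_hom _ _) n ((i : fc_hom _ _) n x) = x.
  exact: (congr1 (fun h : fc_hom A A => h n x) si).
have [|h [_ hE]] := il _ _ (path_ends Q : mor (path Q : FC R) _)
  (@path_ends_has_lifts Q) (path_const i)
  (prodc_tuple (fun b : bool => if b then i ∘ s else idm Q)).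
  apply: fc_hom_ext => n x; apply: functional_extensionality_dep => -[] //.
  exact: (congr1 ((i : fc_hom _ _) n) (siE n x)).
have h1 n x : ((h : fc_hom _ _) n x).1 =
    ((i : fc_hom _ _) n ((s : fc_hom _ _) n x), x).
  have E b :=
    congr1 (fun k : fc_hom Q (prodc (fun _ : bool => Q)) => k n x b) hE.
  rewrite [LHS]surjective_pairing.
  by rewrite [X in (X, _)](E true) [X in (_, X)](E false).
apply/Zr_quasi_isoP; split=> [p n m e y yF dy|p n m e x z xF dx zF dz].
  have mE : m = n - 1 by rewrite e addrK.
  subst m; exists ((s : fc_hom _ _) n y), ((h : fc_hom _ _) n y).2; split.
  - exact: fc_map_F.
  - by rewrite -fc_map_d dy linear0.
  - by have /and3P[] := fc_map_F h yF.
  have := congr1 snd (fc_map_d h erefl y).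
  rewrite dy linear0 /= h1 /= => /esym/eqP; rewrite subr_eq0 => /eqP E.
  apply: (@fc_cast_inj Q _ _ (path_deg (erefl (n + 1)))).
  rewrite [RHS]E; exact: (fc_cast_d erefl).
exists ((s : fc_hom _ _) m z); first exact: fc_map_F.
by rewrite -fc_map_d dz siE.
Qed.

End Path.

(** * Lifting axioms and right properness *)

Section Model.
Variables (R : comPzRingType) (r : nat).

Definition Zr_cof : mor_class (FC R) := fun A B f =>
  forall (X Y : FC R) (g : mor X Y), has_lifts r true g -> lifts f g.

Lemma Zr_cof_sub : subcategory_class Zr_cof.
Proof.
split=> [A X Y g _|A B C g f fc gc X Y k kl]; first exact: lifts_id.
by apply: lifts_comp; [exact: fc|exact: gc].
Qed.

Lemma Zr_cof_retract : retract_closed Zr_cof.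
Proof.
move=> A B C D f g fg gc X Y k kl.
by apply: lifts_retract fg _; exact: gc.
Qed.

Lemma Zr_surjective_sub : subcategory_class (@Zr_surjective R r).
Proof.
split=> [A i j y|A B C g f fs gs i j y]; first by exists y; apply/val_inj.
have [x <-] := gs i j y; have [z <-] := fs i j x.
by exists z; apply/val_inj.
Qed.

Lemma Zr_surjective_retract : retract_closed (@Zr_surjective R r).
Proof.
move=> A B C D f g [s [p [s' [p' [_ ps' _ fp]]]]] gs i j y.
have [x xE] := gs i j (Zr_map r s' i j y).
exists (Zr_map r p i j x); apply/val_inj.
apply: etrans (congr1 (fun h : fc_hom C B => h (j - i) (submod_val x)) fp) _.
apply: etrans
  (congr1 ((p' : fc_hom D B) (j - i)) (congr1 (@submod_val _ _ _ _) xE)) _.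
exact: (congr1 (fun h : fc_hom B B => h (j - i) (submod_val y)) ps').
Qed.

Lemma fibration_lifts (A B C D : FC R) (f : mor A B) (g : mor C D) :
  Zr_cof f -> Zr_quasi_iso r f -> Zr_surjective r g -> lifts f g.
Proof.
move=> fc fq /Zr_surjectiveP gl.
pose Q : FC R := fact_ob r false f.
pose i : mor A Q := fact_in r false f.
pose q : mor Q B := fact_out r false f.
have il : forall (X Y : FC R) (k : mor X Y), has_lifts r false k -> lifts i k.
  exact: fact_in_lifts.
have qs : Zr_surjective r q by apply/Zr_surjectiveP; exact: fact_out_has_lifts.
have E : q ∘ i = f by exact: fact_fact.
(* Both [i] and [f] are weak equivalences, hence so is [q]; the cofibration [f] therefore lifts
   against [q] and is a retract of [i]. *)
apply: (lifts_factor E); last exact: il.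
apply: fc; apply/trivial_fibrationP; split=> //.
have [_ h _] := @Zr_quasi_iso_two_of_three R r _ _ _ q i.
by apply: h; [exact: lifts_fibrations_weq|rewrite E].
Qed.

(** Kept transparent, so that its weak equivalences and fibrations reduce to the prescribed
    classes. *)
Definition Zr_model : model_structure (FC R).
Proof.
refine (@ModelStructure (FC R)
  (@FC_has_small_limits R) (@FC_has_small_colimits R)
  (@Zr_quasi_iso R r) Zr_cof (@Zr_surjective R r) _ Zr_cof_sub Zr_surjective_sub
  (@Zr_quasi_iso_two_of_three R r) (@Zr_quasi_iso_retract R r) Zr_cof_retract
  Zr_surjective_retract fibration_lifts _
  (@lift_factorization R r true _ _ _ _)
  (@lift_factorization R r false _ _ _ _)).
- by split; [exact: Zr_quasi_iso_id|move=> *; exact: Zr_quasi_iso_comp].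
- by move=> A B C D f g fc gs gq; apply: fc; apply/trivial_fibrationP.
- by [].
- by move=> A B f /trivial_fibrationP.
- move=> A B f fl; split; last exact: lifts_fibrations_weq.
  move=> X Y g /trivial_fibrationP[gs _].
  by apply: fl; apply/Zr_surjectiveP.
- by move=> A B f /Zr_surjectiveP.
Defined.

Lemma iso_weq (A B : FC R) (f : mor A B) (g : mor B A) :
  g ∘ f = idm A -> f ∘ g = idm B -> Zr_quasi_iso r f.
Proof.
move=> gf fg i j; exists (Zr_H g (i := i) (j := j)) => c.
  by apply: etrans (esym (Zr_H_comp g f c)) _; rewrite [fc_comp g f]gf Zr_H_id.
by apply: etrans (esym (Zr_H_comp f g c)) _; rewrite [fc_comp f g]fg Zr_H_id.
Qed.

(** The hypothesis on [v] yields pairs that agree in [C] only up to a boundary; lifting what it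
    bounds along the fibration [g] makes them agree exactly, without changing the class. *)
Lemma pb_snd_weq (A B C : FC R) (v : mor A C) (g : mor B C) :
  Zr_surjective r g -> Zr_quasi_iso r v ->
  Zr_quasi_iso r (pb_snd v g : mor (pb v g : FC R) B).
Proof.
move=> /Zr_surjectiveP gs /Zr_quasi_isoP[vs vi].
have lift p n (z : (C : filtered_complex R) n) : z \in fc_F C (p + r%:Z) n ->
    fc_d C (erefl (n + 1)) z \in fc_F C p (n + 1) ->
    exists z' : (B : filtered_complex R) n, [/\ z' \in fc_F B (p + r%:Z) n,
      (g : fc_hom _ _) n z' = z &
      fc_d B (erefl (n + 1)) z' \in fc_F B p (n + 1)].
  move=> zF dzF.
  have [|z' [z'F z'E _ /(_ isT)]] := gs (p + r%:Z) n (n + 1) erefl 0 z.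
    by split=> // _; split=> //; rewrite addrK.
  by rewrite addrK; exists z'.
apply/Zr_quasi_isoP; split=> [p n m e y yF dy|p n m e x z xF dx zF dz].
  subst n.
  (* Here [v b - g y = d z] with [b] a cocycle. For a lift [z'] of [z], the pair [(b, y + d z')]
     lies in the pullback and its second component is cohomologous to [y]. *)
  have [||b [z [bF db zF dz]]] := vs p _ m erefl ((g : fc_hom _ _) _ y).
  - exact: fc_map_F.
  - by rewrite -fc_map_d dy linear0.
  have [|z' [z'F gz' dz'F]] := lift _ _ _ zF.
    by rewrite dz fc_FB ?fc_map_F.
  have E : (v : fc_hom _ _) _ b = (g : fc_hom _ _) _ (y + fc_d B erefl z').
    by rewrite linearD fc_map_d gz' dz [RHS]addrC subrK.
  exists (pb_pair E), z'; split=> //.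
  - by apply: pb_F => //; apply: fc_FD.
  - apply: pb_ext; rewrite fc_map_d linear0 //.
    by rewrite [LHS]linearD /= dy fc_dd addr0.
  - by rewrite [pb_snd _ _ _ _]pb_snd_pair addrAC subrr add0r.
(* Write [x = (b, c)] with [c = d z]. Then [v b = d (g z)], so [b = d s], but the cocycle
   [v s - g z] may be nonzero. It is [v t - d w] for a cocycle [t]; with [w'] a lift of [w], the
   pair [(s - t, z - d w')] lies in the pullback and bounds [x]. *)
subst n; set b := pb_fst v g _ x; set c := pb_snd v g _ x in dz.
have bc : (v : fc_hom _ _) _ b = (g : fc_hom _ _) _ c by exact: pb_comm.
have [||||s sF ds] := vi p _ m erefl b ((g : fc_hom _ _) _ z).
- exact: (fc_map_F (pb_fst v g)).
- by rewrite -fc_map_d dx linear0.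
- exact: fc_map_F.
- by rewrite -fc_map_d dz bc.
have e' : m = (m - 1) + 1 by rewrite subrK.
have [||t [w [tF dt wF dw]]] := vs (p + r%:Z) _ _ e'
  ((v : fc_hom _ _) _ s - (g : fc_hom _ _) _ z).
- by rewrite fc_FB // fc_map_F.
- by rewrite linearB -!fc_map_d ds dz bc subrr.
have [w' [w'F gw' dw'F]] : exists w' : (B : filtered_complex R) (m - 1),
    [/\ w' \in fc_F B (p + r%:Z + r%:Z) (m - 1),
      (g : fc_hom _ _) _ w' = w & fc_d B e' w' \in fc_F B (p + r%:Z) m].
  have [|w' [w'F w'E _ /(_ isT)]] := gs (p + r%:Z + r%:Z) _ _ e' 0 w.
    split=> // _; split=> //.
    by rewrite addrK dw !fc_FB ?fc_map_F // fc_FB ?fc_map_F.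
  by rewrite addrK; exists w'.
have E : (v : fc_hom _ _) _ (s - t) = (g : fc_hom _ _) _ (z - fc_d B e' w').
  rewrite !linearB fc_map_d gw' dw opprB addrA; congr (_ - _).
  by rewrite [RHS]addrC subrK.
exists (pb_pair E).
  by apply: pb_F; apply: fc_FB.
by apply: pb_ext; rewrite fc_map_d /= linearB ?ds ?dt ?subr0 // fc_dd subr0.
Qed.

(** Any pullback is isomorphic to the explicit [pb], whose elements are pairs, and isomorphisms are
    weak equivalences. *)
Lemma Zr_model_right_proper : right_proper Zr_model.
Proof.
move=> a b c d f u v g [sq univ] gs vq.
have comm : v ∘ (pb_fst v g : mor (pb v g : FC R) b) = g ∘ pb_snd v g.
  by apply: fc_hom_ext => n z; exact: pb_comm.
have [k [[fk uk] _]] := univ _ _ _ comm.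
pose h : mor a (pb v g : FC R) := pb_hom sq.
have hk : h ∘ k = idm (pb v g : FC R).
  apply: fc_hom_ext => n x; apply: pb_ext.
    exact: (congr1 (fun l : fc_hom (pb v g) b => l n x) fk).
  exact: (congr1 (fun l : fc_hom (pb v g) c => l n x) uk).
have kh : k ∘ h = idm a.
  have [l [_ lu]] := univ _ f u sq.
  have <- : l = k ∘ h.
    apply: lu; split; [rewrite mcompA fk|rewrite mcompA uk]; exact: fc_hom_ext.
  by apply: lu; split; exact: mcompm1.
have -> : u = (pb_snd v g : mor (pb v g : FC R) c) ∘ h by exact: fc_hom_ext.
apply: Zr_quasi_iso_comp; first exact: iso_weq kh hk.
exact: pb_snd_weq.
Qed.

End Model.

(** * Generating cofibrations *)

Section Rif.
Variable R : comPzRingType.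

(** With [Rif_coef], a generator and a coordinate uniform in [b]: a linear map out of [Rif b] is
    given by one element, with no case analysis on the degree. *)
Definition Rif_one (b : bool) : Rif R b :=
  if b return Rif R b then (1 : R) else 0.

Definition Rif_coef (b : bool) : Rif R b -> R :=
  if b return Rif R b -> R then id else fun=> 0.

Lemma Rif_coef_linear b a (x y : Rif R b) :
  Rif_coef (a *: x + y) = a * Rif_coef x + Rif_coef y.
Proof. by case: b x y => //= x y; rewrite mulr0 addr0. Qed.

Lemma Rif_coefK b (x : Rif R b) : Rif_coef x *: Rif_one b = x.
Proof. by case: b x => x /=; [exact: mulr1|rewrite [x]thinmx0 scaler0]. Qed.

Lemma Rif_coef_one (b : bool) : b -> Rif_coef (Rif_one b) = 1.
Proof. by case: b. Qed.

Lemma Rif_coef0 b (x : Rif R b) : ~~ b -> Rif_coef x = 0.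
Proof. by case: b x. Qed.

Lemma Rif_coef_map (b c : bool) (x : Rif R b) :
  c -> Rif_coef (Rif_map R b c x) = Rif_coef x.
Proof. by case: b c x => [] []. Qed.

Lemma Rif_map_one (b c : bool) : b -> Rif_map R b c (Rif_one b) = Rif_one c.
Proof. by case: b c => [] []. Qed.

Lemma Rif_lin_linear (V : lmodType R) (v : V) b :
  linear (fun x : Rif R b => Rif_coef x *: v).
Proof. by move=> a x y; rewrite Rif_coef_linear scalerDl scalerA. Qed.

Definition Rif_lin (V : lmodType R) (v : V) b : {linear Rif R b -> V} :=
  linear_of (@Rif_lin_linear V v b).

Lemma Rif_linear_ext (V : lmodType R) b (f g : {linear Rif R b -> V}) :
  f (Rif_one b) = g (Rif_one b) -> f =1 g.
Proof. by move=> fg x; rewrite -[x]Rif_coefK !linearZ /= fg. Qed.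

Lemma Rif_linear_ext0 (V : lmodType R) b (f g : {linear Rif R b -> V}) :
  ~~ b -> f =1 g.
Proof. by case: b f g => // f g _ x; rewrite [x]thinmx0 !linear0. Qed.

End Rif.

(** * Maps out of the generating complexes as elements *)

Section Representing.
Variables (R : comPzRingType) (B : filtered_complex R).

Lemma fc_F_le p q n (x : B n) : p <= q -> x \in fc_F B p n -> x \in fc_F B q n.
Proof.
move=> pq xF; have -> : q = p + `|q - p|%N%:Z by lia.
exact: fc_F_incr_nat.
Qed.

Lemma Rif_lin_F (s : int -> bool) (w : int -> int) (q m : int) (v : B m)
    (x : Rif R (s m)) :
  v \in fc_F B (w m) m -> x \in @pure_F R s w q m ->
  Rif_lin v (s m) x \in fc_F B q m.
Proof.
move=> vF /orP[wq|/eqP ->].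
  by rewrite /= -[_ *: _]addr0 fc_FP ?fc_F0 // (fc_F_le wq).
by rewrite linear0 fc_F0.
Qed.

Section FromPure.
Variables (p n : int) (x : B n).
Hypotheses (xF : x \in fc_F B p n) (dx : fc_d B (erefl (n + 1)) x = 0).

Let elt m : B m := if pselect (n = m) is left e then fc_cast B e x else 0.

Lemma pure_elt_F m : elt m \in fc_F B p m.
Proof.
by rewrite /elt; case: pselect => [e|_]; [exact: fc_cast_F|exact: fc_F0].
Qed.

Lemma pure_hom_d m l (e : l = m + 1) (y : pure_complex R p n m) :
  Rif_lin (elt l) (l == n) (fc_d (pure_complex R p n) e y) =
  fc_d B e (Rif_lin (elt m) (m == n) y).
Proof.
rewrite [fc_d (pure_complex R p n) _ _]/= linear0 [Rif_lin _ _ _]/= linearZ /=.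
rewrite /elt; case: pselect => [em|_]; last by rewrite linear0 scaler0.
by subst m; rewrite [fc_d B e _](fc_d_eq0 e dx) scaler0.
Qed.

(** With [pure_hom_ext], the pure complex represents the cocycles of weight [p] and degree [n]. *)
Definition pure_hom : fc_hom (pure_complex R p n) B :=
  @FCHom R (pure_complex R p n) B (fun m => Rif_lin (elt m) (m == n)) pure_hom_d
    (fun q m y =>
      @Rif_lin_F (fun m => m == n) (fun=> p) q m _ y (pure_elt_F m)).

Lemma pure_hom_one : pure_hom n (Rif_one R (n == n)) = x.
Proof.
rewrite /= Rif_coef_one ?eqxx // scale1r /elt; case: pselect => // e.
by rewrite (Prop_irrelevance e erefl).
Qed.

End FromPure.

Lemma pure_hom_ext p n (f g : fc_hom (pure_complex R p n) B) :
  f n (Rif_one R (n == n)) = g n (Rif_one R (n == n)) -> f = g.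
Proof.
move=> fg; apply: fc_hom_ext => m.
have [->|mn] := eqVneq m n; first exact: Rif_linear_ext.
exact: Rif_linear_ext0.
Qed.

Lemma pure_one_F p n :
  (Rif_one R (n == n) : pure_complex R p n n) \in fc_F (pure_complex R p n) p n.
Proof. by rewrite unfold_in lexx. Qed.

Section FromZr.
Variables (r : nat) (p n : int) (x : B n).
Hypotheses (xF : x \in fc_F B p n)
  (dxF : fc_d B (erefl (n + 1)) x \in fc_F B (p - r%:Z) (n + 1)).

Let s (m : int) := (m == n) || (m == n + 1).
Let w (m : int) := if m == n then p else p - r%:Z.

Let elt m : B m :=
  if pselect (n = m) is left e then fc_cast B e x else
  if pselect (m = n + 1) is left e then fc_d B e x else 0.

Let elt_n : elt n = x.
Proof.
by rewrite /elt; case: pselect => // e; rewrite (Prop_irrelevance e erefl).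
Qed.

Let elt_n1 m (e : m = n + 1) : elt m = fc_d B e x.
Proof.
rewrite /elt; case: pselect => [e'|_]; first by exfalso; lia.
by case: pselect => // e'; rewrite (Prop_irrelevance e e').
Qed.

Let elt0 m : ~~ s m -> elt m = 0.
Proof.
rewrite /s /elt => /norP[/eqP mn /eqP mn1].
by case: pselect => [/esym//|_]; case: pselect.
Qed.

Lemma Zr_elt_F m : elt m \in fc_F B (w m) m.
Proof.
rewrite /elt /w; case: pselect => [e|nm].
  by subst m; rewrite eqxx.
case: pselect => [e|_]; last exact: fc_F0.
by rewrite ifF; [subst m|apply/eqP => /esym].
Qed.

Lemma Zr_hom_d m l (e : l = m + 1) (y : Zr_complex R r p n m) :
  Rif_lin (elt l) (s l) (fc_d (Zr_complex R r p n) e y) =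
  fc_d B e (Rif_lin (elt m) (s m) y).
Proof.
rewrite /= linearZ /=.
have [sm|nsm] : s m \/ ~~ s m by case: (s m); [left|right].
  have [mn|mn] : m = n \/ m = n + 1 by move: sm => /orP[]/eqP; [left|right].
    subst m l; rewrite elt_n (elt_n1 erefl).
    by congr (_ *: _); apply: Rif_coef_map; rewrite /s eqxx orbT.
  subst m; rewrite (elt_n1 erefl) fc_dd elt0 ?scaler0 //.
  by apply/negP; rewrite /s => /orP[]/eqP; lia.
rewrite [Rif_coef y](@Rif_coef0 R (s m) y) // scale0r.
have [sl|nsl] : s l \/ ~~ s l by case: (s l); [left|right].
  by rewrite (@Rif_coef_map R (s m) (s l)) // (@Rif_coef0 R (s m) y) ?scale0r.
by rewrite elt0 ?scaler0.
Qed.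

(** With [Zr_hom_ext], this complex represents the component of [Z_r] of weight [p] and degree [n],
    which is why lifting against [J''_r] means surjectivity of [Z_r]. *)
Definition Zr_hom : fc_hom (Zr_complex R r p n) B :=
  @FCHom R (Zr_complex R r p n) B (fun m => Rif_lin (elt m) (s m)) Zr_hom_d
    (fun q m y => @Rif_lin_F s w q m _ y (Zr_elt_F m)).

Lemma Zr_hom_one : Zr_hom n (Rif_one R (s n)) = x.
Proof. by rewrite /= Rif_coef_one ?scale1r //= /s eqxx. Qed.

End FromZr.

Section ZrOne.
Variables (r : nat) (p n : int).

Definition Zr_one m : Zr_complex R r p n m :=
  Rif_one R ((m == n) || (m == n + 1)).

Lemma Zr_one_F : Zr_one n \in fc_F (Zr_complex R r p n) p n.
Proof. by apply/orP; left; rewrite eqxx. Qed.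

Lemma Zr_one_d : fc_d (Zr_complex R r p n) erefl (Zr_one n) = Zr_one (n + 1).
Proof. by apply: Rif_map_one; rewrite eqxx. Qed.

Lemma Zr_one_dF :
  Zr_one (n + 1) \in fc_F (Zr_complex R r p n) (p - r%:Z) (n + 1).
Proof. by apply/orP; left; rewrite ifF //; apply/eqP; lia. Qed.

Lemma Zr_hom_ext (f g : fc_hom (Zr_complex R r p n) B) :
  f n (Zr_one n) = g n (Zr_one n) -> f = g.
Proof.
move=> fg; apply: fc_hom_ext => m.
have [->|mn] := eqVneq m n; first exact: Rif_linear_ext.
have [->|mn1] := eqVneq m (n + 1); last first.
  by apply: Rif_linear_ext0; rewrite negb_or mn.
apply: Rif_linear_ext.
by rewrite -/(Zr_one (n + 1)) -Zr_one_d !fc_map_d fg.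
Qed.

End ZrOne.

End Representing.

(** * Lifting against the generating sets *)

Section Generators.
Variables (R : comPzRingType) (r : nat).

(** By representability a square is a cocycle [x] of [A] together with [y] in [B]. Its commutativity
    need only be tested on the generator in degree [n + 1], where it reads [f x = d y]. *)
Lemma rlp_I (A B : FC R) (f : mor A B) :
  rlp_class (@I''_ R r) f <-> has_lifts r true f.
Proof.
split=> [fl p n m e x y [yF /(_ isT)[xF dx fx] _]|fl [p n] /= u v E].
  subst m; have dyF : fc_d B (erefl (n + 1)) y \in fc_F B (p - r%:Z) (n + 1).
    by rewrite -fx fc_map_F.
  have [|h [hi fh]] := fl (p, n) (pure_hom xF dx) (Zr_hom yF dyF).
    apply: pure_hom_ext; apply: etrans (_ : fc_d B erefl y = _).
      have -> : fc_d B erefl y = Zr_hom yF dyF (n + 1) (Zr_one R r p n (n + 1)).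
        by rewrite -Zr_one_d fc_map_d [Zr_hom _ _ _ _]Zr_hom_one.
      apply: (congr1 (Zr_hom yF dyF (n + 1))).
      by apply: Rif_map_one; rewrite eqxx.
    rewrite -fx; apply: (congr1 ((f : fc_hom _ _) (n + 1))).
    by rewrite pure_hom_one.
  pose k : fc_hom (Zr_complex R r p n) A := h.
  exists (k n (Zr_one R r p n n)); split=> // [||_].
  - by apply: fc_map_F; exact: Zr_one_F.
  - apply: etrans (Zr_hom_one yF dyF).
    exact: (congr1 (fun l : fc_hom (Zr_complex R r p n) B =>
      l n (Zr_one R r p n n)) fh).
  rewrite -fc_map_d Zr_one_d -(pure_hom_one xF dx).
  have := congr1 (fun l : fc_hom (pure_complex R (p - r%:Z) (n + 1)) A =>
    l (n + 1) (Rif_one R (n + 1 == n + 1))) hi.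
  move=> <-; apply: (congr1 (k (n + 1))); apply: esym.
  by apply: Rif_map_one; rewrite eqxx.
pose U : fc_hom (pure_complex R (p - r%:Z) (n + 1)) A := u.
pose V : fc_hom (Zr_complex R r p n) B := v.
have E1 : (f : fc_hom _ _) (n + 1) (U (n + 1) (Rif_one R (n + 1 == n + 1))) =
    V (n + 1) (Zr_one R r p n (n + 1)).
  have := congr1 (fun l : fc_hom (pure_complex R (p - r%:Z) (n + 1)) B =>
    l (n + 1) (Rif_one R (n + 1 == n + 1))) E.
  move=> /esym E2; apply: etrans E2 _; apply: (congr1 (V (n + 1))).
  by apply: Rif_map_one; rewrite eqxx.
have [|x [xF fx /(_ isT) dx _]] := fl p n (n + 1) erefl
    (U (n + 1) (Rif_one R (n + 1 == n + 1))) (V n (Zr_one R r p n n)).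
  split=> // [|_].
    by apply: fc_map_F; exact: Zr_one_F.
  split.
  - by apply: fc_map_F; exact: pure_one_F.
  - by rewrite -fc_map_d linear0.
  - by rewrite E1 -Zr_one_d fc_map_d.
have dxF : fc_d A (erefl (n + 1)) x \in fc_F A (p - r%:Z) (n + 1).
  by rewrite dx; apply: fc_map_F; exact: pure_one_F.
exists (Zr_hom xF dxF : mor (_ : FC R) _); split.
  apply: pure_hom_ext; rewrite -/(U _ _) -dx.
  apply: etrans (_ : Zr_hom xF dxF (n + 1) (Zr_one R r p n (n + 1)) = _).
    apply: (congr1 (Zr_hom xF dxF (n + 1))).
    by apply: Rif_map_one; rewrite eqxx.
  by rewrite -Zr_one_d fc_map_d [Zr_hom _ _ _ _]Zr_hom_one.
apply: Zr_hom_ext; apply: etrans _ fx.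
exact: (congr1 ((f : fc_hom _ _) n) (Zr_hom_one xF dxF)).
Qed.

Lemma rlp_J (A B : FC R) (f : mor A B) :
  rlp_class (@J''_ R r) f <-> has_lifts r false f.
Proof.
split=> [fl p n m e x y [yF _ /(_ isT)[-> dyF]]|fl [p n] /= u v E].
  subst m; have [|h [_ fh]] := fl (p, n) (from_zero A) (Zr_hom yF dyF).
    exact: from_zero_unique.
  pose k : fc_hom (Zr_complex R r p n) A := h.
  exists (k n (Zr_one R r p n n)); split=> // [||_].
  - by apply: fc_map_F; exact: Zr_one_F.
  - apply: etrans (Zr_hom_one yF dyF).
    exact: (congr1 (fun l : fc_hom (Zr_complex R r p n) B =>
      l n (Zr_one R r p n n)) fh).
  by rewrite -fc_map_d Zr_one_d; apply: fc_map_F; exact: Zr_one_dF.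
pose V : fc_hom (Zr_complex R r p n) B := v.
have [|x [xF fx _ /(_ isT) dxF]] :=
  fl p n (n + 1) erefl 0 (V n (Zr_one R r p n n)).
  split=> // [|_].
    by apply: fc_map_F; exact: Zr_one_F.
  by split=> //; rewrite -fc_map_d Zr_one_d; apply: fc_map_F; exact: Zr_one_dF.
exists (Zr_hom xF dxF : mor (_ : FC R) _); split.
  exact: from_zero_unique.
apply: Zr_hom_ext; apply: etrans _ fx.
exact: (congr1 ((f : fc_hom _ _) n) (Zr_hom_one xF dxF)).
Qed.

End Generators.

(** * Smallness *)

Section QuotientComplex.
Variables (R : comPzRingType) (A : filtered_complex R).
Variable S : forall n, {pred A n}.
Hypothesis cS : forall n, submod_closed (@S n).
Hypothesis dS : forall n m (e : m = n + 1) (x : A n),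
  x \in @S n -> fc_d A e x \in @S m.

Let M n : lmodType R := quotmod (cS n).

Definition quotc_pi_fun n (x : A n) : M n := quotmod_pi (cS n) x.

Definition quotc_d_fun n m (e : m = n + 1) (q : M n) : M m :=
  quotc_pi_fun (fc_d A e (repr (q : Quotient.quot (submod_pred (cS n))))).

Lemma quotc_pi_eq n (x y : A n) :
  quotc_pi_fun x = quotc_pi_fun y <-> x - y \in @S n.
Proof. by rewrite -(quotmod_piE (cS n)); split=> /eqP. Qed.

Lemma quotc_dE n m (e : m = n + 1) (x : A n) :
  quotc_d_fun e (quotc_pi_fun x) = quotc_pi_fun (fc_d A e x).
Proof.
apply/quotc_pi_eq; rewrite -linearB; apply: dS.
by apply/quotc_pi_eq; exact: (@reprK _ (Quotient.quot (submod_pred (cS n)))).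
Qed.

Lemma quotc_d_linear n m (e : m = n + 1) : linear (quotc_d_fun e).
Proof.
move=> a x y; elim/quotmod_ind: x => x; elim/quotmod_ind: y => y.
rewrite -(quotmod_pi_linear (cS n)) !quotc_dE linearP.
exact: quotmod_pi_linear.
Qed.

Lemma quotc_dd n m l (e : m = n + 1) (e' : l = m + 1) (x : M n) :
  quotc_d_fun e' (quotc_d_fun e x) = 0.
Proof.
elim/quotmod_ind: x => x; rewrite !quotc_dE fc_dd.
exact: (linear0 (linear_of (quotmod_pi_linear (cS l)))).
Qed.

(** Every weight is the whole module: the quotient only has to detect which elements vanish, and
    morphisms into it then carry no condition on weights. *)
Definition quotc : filtered_complex R :=
  @FilteredComplex R M (fun n m e => linear_of (quotc_d_linear e)) quotc_dd
    (fun _ _ => predT) (fun _ _ => conj isT (fun _ _ _ _ _ => isT))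
    (fun _ _ _ _ => isT) (fun _ _ _ _ _ _ => isT).

Definition quotc_pi : fc_hom A quotc :=
  @FCHom R A quotc (fun n => linear_of (quotmod_pi_linear (cS n)))
    (fun n m e x => esym (quotc_dE e x)) (fun _ _ _ _ => isT).

End QuotientComplex.

(** * Elements of sequential colimits *)

Section Sequential.
Variables (R : comPzRingType) (W : wellorder) (X : functor (wo_cat W) (FC R)).
Variables (L : FC R) (c : cocone X L).
Hypothesis cL : is_colimit c.

Let leg (w : W) : fc_hom (X w) L := cocone_leg c w.
Let step (v w : W) (h : wle v w) : fc_hom (X v) (X w) := @fmap _ _ X v w h.

Let leg_step (v w : W) (h : wle v w) n x : leg w n (step h n x) = leg v n x.
Proof. exact: (congr1 (fun k : fc_hom (X v) L => k n x) (cocone_nat c h)). Qed.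

Let step_step (u v w : W) (h : wle v w) (h' : wle u v) (h'' : wle u w) n x :
  step h n (step h' n x) = step h'' n x.
Proof.
have -> : h'' = wle_trans h h' by exact: Prop_irrelevance.
exact: (congr1 (fun k : fc_hom (X u) (X w) => k n x)
  (esym (@fmap_comp _ _ X u v w h h'))).
Qed.

Lemma wle_upper (v w : W) : exists u, wle v u /\ wle w u.
Proof.
have [vw|[->|wv]] := wlt_total v w.
- by exists w; split; [right|left].
- by exists w; split; left.
- by exists v; split; [left|right].
Qed.

(* The union of the images of the legs, filtered by the images of the
   filtrations, is also a cocone, hence it is the whole of [L]. *)
Section Image.
Variable w0 : W.

Let S n : {pred (L : filtered_complex R) n} :=
  fun x => `[< exists w a, x = leg w n a >].
Let G p n : {pred (L : filtered_complex R) n} :=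
  fun x => `[< exists w a, a \in fc_F (X w) p n /\ x = leg w n a >].

Let cS n : submod_closed (@S n).
Proof.
split=> [|k x y]; first by apply/asboolP; exists w0, 0; rewrite linear0.
move=> /asboolP[v [a ->]] /asboolP[w [b ->]]; apply/asboolP.
have [u [vu wu]] := wle_upper v w.
exists u, (k *: step vu n a + step wu n b).
by rewrite linearP !leg_step.
Qed.

Let dS n m (e : m = n + 1) (x : (L : filtered_complex R) n) :
  x \in @S n -> fc_d L e x \in @S m.
Proof.
move=> /asboolP[w [a ->]]; apply/asboolP; exists w, (fc_d (X w) e a).
by rewrite fc_map_d.
Qed.

Let cG p n : submod_closed (@G p n).
Proof.
split=> [|k x y].
  by apply/asboolP; exists w0, 0; rewrite linear0 fc_F0.
move=> /asboolP[v [a [aF ->]]] /asboolP[w [b [bF ->]]]; apply/asboolP.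
have [u [vu wu]] := wle_upper v w.
exists u, (k *: step vu n a + step wu n b).
by rewrite linearP !leg_step; split=> //; apply: fc_FP; exact: fc_map_F.
Qed.

Let G_incr p n (x : (L : filtered_complex R) n) :
  x \in @G (p - 1) n -> x \in @G p n.
Proof.
move=> /asboolP[w [a [aF ->]]]; apply/asboolP; exists w, a; split=> //.
exact: fc_F_incr.
Qed.

Let dG p n m (e : m = n + 1) (x : (L : filtered_complex R) n) :
  x \in @G p n -> fc_d L e x \in @G p m.
Proof.
move=> /asboolP[w [a [aF ->]]]; apply/asboolP; exists w, (fc_d (X w) e a).
by rewrite fc_map_d; split=> //; exact: fc_dF.
Qed.

Let GF p n (x : (L : filtered_complex R) n) : x \in @G p n -> x \in fc_F L p n.
Proof. by move=> /asboolP[w [a [aF ->]]]; exact: fc_map_F. Qed.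

Let image : FC R := subcomplex cS dS cG G_incr dG.
Let incl : mor image L := subc_incl cS dS cG G_incr dG GF.

Let leg_S (w : W) n x : leg w n x \in @S n.
Proof. by apply/asboolP; exists w, x. Qed.

Let leg_G (w : W) p n x : x \in fc_F (X w) p n -> leg w n x \in @G p n.
Proof. by move=> xF; apply/asboolP; exists w, x. Qed.

Let image_leg (w : wo_cat W) : mor (X w) image :=
  subc_cores cS dS cG G_incr dG (@leg_S w) (@leg_G w).

Let image_nat (v w : wo_cat W) (h : mor v w) :
  image_leg w ∘ fmap X h = image_leg v.
Proof.
by apply: fc_hom_ext => n x; apply/val_inj; exact: leg_step.
Qed.

Lemma seq_colimit_surj p n (x : (L : filtered_complex R) n) :
  x \in fc_F L p n ->
  exists w (a : (X w : filtered_complex R) n),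
    a \in fc_F (X w) p n /\ x = (cocone_leg c w : fc_hom _ _) n a.
Proof.
move=> xF; have [h [hE _]] := cL (Cocone image_nat).
(* Both sides are maps of the cocone [c] to itself. Hence each element comes from some stage, with
   its weight, since [h] preserves weights and those of the image come from the stages. *)
have E : incl ∘ h = idm L.
  have [l [_ lu]] := cL c; apply: etrans (esym (lu _ _)) (lu _ _) => w.
    rewrite -mcompA hE; exact: fc_hom_ext.
  exact: mcomp1m.
have := congr1 (fun k : fc_hom L L => k n x) E.
have /asboolP[w [a [aF aE]]] : (h : fc_hom L image) n x \in fc_F image p n.
  exact: fc_map_F.
by move=> /= <-; exists w, a.
Qed.

End Image.

(* The families modulo those vanishing from some stage on receive a cocone, whose
   legs kill only the elements killed at some later stage. *)
Section Tails.

Let P : filtered_complex R := @prodc R (wo W) (fun w => X w).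

Let S n : {pred P n} := fun x => `[< exists w, forall v, wle w v -> x v = 0 >].

Variable w0 : W.

Let cS n : submod_closed (@S n).
Proof.
split=> [|k x y]; first by apply/asboolP; exists w0.
move=> /asboolP[v xv] /asboolP[w yw]; apply/asboolP.
have [u [vu wu]] := wle_upper v w; exists u => t ut.
by rewrite prodmodP xv ?yw ?scaler0 ?addr0 //; apply: wle_trans ut _.
Qed.

Let dS n m (e : m = n + 1) (x : P n) : x \in @S n -> fc_d P e x \in @S m.
Proof.
move=> /asboolP[w xw]; apply/asboolP; exists w => v wv.
by rewrite [LHS]/= /prodc_d_fun xw // linear0.
Qed.

Let tails : FC R := quotc cS dS.

(** Padding by zero is harmless: the tail of an element and that of its image at a later stage agree
    from that stage on, hence in the quotient. *)
Let tail_fun (w : W) n (x : (X w : filtered_complex R) n) : P n :=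
  fun v => if pselect (wle w v) is left h then step h n x else 0.

Let tail_funE (w v : W) (h : wle w v) n x : @tail_fun w n x v = step h n x.
Proof.
by rewrite /tail_fun; case: pselect => // h'; rewrite (Prop_irrelevance h' h).
Qed.

Let tail_linear (w : W) n : linear (@tail_fun w n).
Proof.
move=> a x y; apply: functional_extensionality_dep => v.
rewrite prodmodP /tail_fun; case: pselect => [h|_]; first exact: linearP.
by rewrite scaler0 addr0.
Qed.

Let tail_d (w : W) n m (e : m = n + 1) (x : (X w : filtered_complex R) n) :
  tail_fun (fc_d (X w) e x) = fc_d P e (tail_fun x).
Proof.
apply: functional_extensionality_dep => v.
rewrite [RHS]/= /prodc_d_fun /tail_fun.
by case: pselect => [h|_]; [exact: fc_map_d|rewrite linear0].
Qed.

Let tail_F (w : W) p n (x : (X w : filtered_complex R) n) :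
  x \in fc_F (X w) p n -> tail_fun x \in fc_F P p n.
Proof.
move=> xF; apply/asboolP => v; rewrite /tail_fun.
by case: pselect => [h|_]; [exact: fc_map_F|exact: fc_F0].
Qed.

Let tail (w : W) : fc_hom (X w) P :=
  @FCHom R (X w) P (fun n => linear_of (@tail_linear w n))
    (@tail_d w) (@tail_F w).

Let tails_leg (w : wo_cat W) : mor (X w) tails :=
  fc_comp (quotc_pi cS dS) (tail w).

Let tails_nat (v w : wo_cat W) (h : mor v w) :
  tails_leg w ∘ fmap X h = tails_leg v.
Proof.
apply: fc_hom_ext => n x; apply/(quotc_pi_eq cS)/asboolP; exists w => u wu.
have vu : wle v u by apply: wle_trans wu h.
rewrite -[LHS]/(tail_fun (step h n x) u - tail_fun x u).
by rewrite (tail_funE wu) (tail_funE vu) (step_step wu h vu) subrr.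
Qed.

Lemma seq_colimit_ker w n (a : (X w : filtered_complex R) n) :
  (cocone_leg c w : fc_hom _ _) n a = 0 ->
  exists v (h : wle w v), step h n a = 0.
Proof.
move=> a0; have [h [hE _]] := cL (Cocone tails_nat).
have : (tails_leg w : fc_hom _ _) n a = (quotc_pi cS dS) n 0.
  rewrite -[tails_leg w](hE w) linear0.
  exact: etrans (congr1 ((h : fc_hom L tails) n) a0) (linear0 _).
move=> /(quotc_pi_eq cS); rewrite subr0 => /asboolP[v av].
have [u [vu wu]] := wle_upper v w; exists u, wu.
by rewrite -(tail_funE wu); exact: av.
Qed.

End Tails.

End Sequential.

Section Smallness.
Variables (R : comPzRingType) (D : mor_class (FC R)).

(** The cardinal is [unit] because a map out of the pure complex is a single cocycle, and finitely
    many conditions on elements can be met at one stage. *)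
Lemma pure_small p n : small_relative (pure_complex R p n) D.
Proof.
exists unit => W [[w0 _] _ _] X _ _ L c cL.
pose one : pure_complex R p n n := Rif_one R (n == n).
have legE (u v : wo_cat W) (h : mor u v) m x :
    (cocone_leg c v : fc_hom _ _) m ((fmap X h : fc_hom _ _) m x) =
    (cocone_leg c u : fc_hom _ _) m x.
  exact: (congr1 (fun k : fc_hom (X u) L => k m x) (cocone_nat c h)).
split=> [f|v w g g' E].
  pose x := (f : fc_hom _ _) n one.
  have xF : x \in fc_F L p n by apply: fc_map_F; exact: pure_one_F.
  have [w [a [aF xa]]] := seq_colimit_surj cL w0 xF.
  (* The preimage [a] has the right weight but need not be a cocycle; [d a] vanishes in the colimit,
     hence at some later stage. *)
  have [|v [h da]] :=
    @seq_colimit_ker _ _ _ _ _ cL w0 w (n + 1) (fc_d (X w) erefl a).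
    by rewrite fc_map_d -xa /x -fc_map_d linear0.
  pose b := (fmap X (h : mor (w : wo_cat W) v) : fc_hom _ _) n a.
  have bF : b \in fc_F (X v) p n by exact: fc_map_F.
  have db : fc_d (X v) erefl b = 0 by rewrite -da -fc_map_d.
  exists v, (pure_hom bF db); apply: pure_hom_ext; rewrite -/one -/x.
  apply: etrans
    (congr1 ((cocone_leg c v : fc_hom _ _) n) (esym (pure_hom_one bF db))).
  by rewrite legE.
have [u [vu wu]] := wle_upper v w.
pose a := (fmap X (vu : mor (v : wo_cat W) u) ∘ g : fc_hom _ _) n one.
pose a' := (fmap X (wu : mor (w : wo_cat W) u) ∘ g' : fc_hom _ _) n one.
(* The two cocycles are compared at a common stage [u]; their difference vanishes in the colimit,
   hence at a later stage [t]. *)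
have [|t [ut at0]] := @seq_colimit_ker _ _ _ _ _ cL w0 u n (a - a').
  rewrite linearB !legE; apply/eqP; rewrite subr_eq0; apply/eqP.
  exact: (congr1 (fun k : fc_hom (pure_complex R p n) L => k n one) E).
exists t, (wle_trans ut vu), (wle_trans ut wu); apply: pure_hom_ext.
rewrite (@fmap_comp _ _ X v u t ut vu) (@fmap_comp _ _ X w u t ut wu).
apply/eqP; rewrite -subr_eq0; apply/eqP.
by rewrite -[RHS]at0 [RHS]linearB.
Qed.

Lemma zero_small : small_relative (zero_complex R) D.
Proof.
exists unit => W [[w0 _] _ _] X _ _ L c cL; split=> [f|v w g g' _].
  by exists w0, (from_zero (X w0)); exact: from_zero_unique.
have [u [vu wu]] := wle_upper v w.
by exists u, vu, wu; exact: from_zero_unique.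
Qed.

End Smallness.

Theorem theorem3p25 (R : comPzRingType) (r : nat) :
  exists M : model_structure (FC R),
    [/\ right_proper M,
        forall (A B : FC R) (f : mor A B), weq M f <-> Zr_quasi_iso r f,
        forall (A B : FC R) (f : mor A B), fib M f <-> Zr_surjective r f
      & cofibrantly_generated M (@I''_ R r) (@J''_ R r)].
Proof.
exists (Zr_model R r); split=> //; first exact: Zr_model_right_proper.
split=> [[p n]|[p n]|A B f|A B f].
- exact: pure_small.
- exact: zero_small.
- by rewrite rlp_J; exact: Zr_surjectiveP.
- by rewrite rlp_I trivial_fibrationP.
Qed.
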